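(* Let $1\le k<d$, let $b\in\mathbb{R}^k$, let $M,K\in\mathbb{R}^{d\times d}$ and $C\in\mathbb{R}^{d\times n}$ be given matrices, and let $W_t$ be a standard Brownian motion in $\mathbb{R}^n$. Let $\xi:\mathbb{R}^d\to\mathbb{R}^k$, $\xi(x)=x^1-b$. For $\varepsilon>0$ let $X^\varepsilon_t$ be the solution to $$dX_t = MX_t\,dt-\frac{1}{2\varepsilon}K\nabla|\xi(X_t)|^2\,dt+\sqrt2\,C\,dW_t$$ with (random) initial datum $X^\varepsilon|_{t=0}=X^\varepsilon_0$. Assume that 1. $-K_{11}\in\mathbb{R}^{k\times k}$ is Hurwitz; 2. $X^\varepsilon_0\to X_0$ in probability as $\varepsilon\to0$. Then for any $t>0$, $$X^\varepsilon_t\to Y_t\quad\text{in probability as }\varepsilon\to0,$$ where $Y_t$ is the solution to the SDE in $\mathbb{R}^d$ $$dY_t=PMY_t\,dt+\sqrt2\,PC\,dW_t,$$ with $$P:=\begin{pmatrix}0_{k\times k}&0_{k\times(d-k)}\\ \alpha&I_{(d-k)\times(d-k)}\end{pmatrix},\qquad \alpha:=-K_{21}K_{11}^{-1}\in\mathbb{R}^{(d-k)\times k},$$ and initial datum $$Y|_{t=0}=P\left(X_0-\begin{pmatrix}b\\0\end{pmatrix}\right)+\begin{pmatrix}b\\0\end{pmatrix}.$$ Writing $Y_t=(Y^1_t,Y^2_t)^T$ with $Y^1_t\in\mathbb{R}^k$ and $Y^2_t\in\mathbb{R}^{d-k}$, the limit SDE can be written explicitly as $$dY^1_t=0,\qquad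 dY^2_t=\big[(\alpha M_{11}+M_{21})Y^1_t+(\alpha M_{12}+M_{22})Y^2_t\big]dt+\sqrt2\,\hat C\,dW_t,$$ where $\hat C=(\alpha C_{11}+C_{21}\ \ \ \alpha C_{12}+C_{22})\in\mathbb{R}^{(d-k)\times n}$, with initial data $$Y^1|_{t=0}=b,\qquad Y^2|_{t=0}=\alpha X^1_0+X^2_0-\alpha b,$$ where $X_0=(X^1_0,X^2_0)^T$. In particular $Y^1_t\equiv Y^1|_{t=0}$ and therefore $\xi(Y_t)=0$ for any $t\ge0$.
   Context: Vectors $x\in\mathbb{R}^d$ are split as $x=(x^1,x^2)^T\in\mathbb{R}^k\times\mathbb{R}^{d-k}$. A matrix $S\in\mathbb{R}^{d\times d}$ is partitioned into blocks $S=\begin{pmatrix}S_{11}&S_{12}\\S_{21}&S_{22}\end{pmatrix}$ with $S_{11}\in\mathbb{R}^{k\times k}$, $S_{12}\in\mathbb{R}^{k\times(d-k)}$, $S_{21}\in\mathbb{R}^{(d-k)\times k}$, $S_{22}\in\mathbb{R}^{(d-k)\times(d-k)}$. For $C\in\mathbb{R}^{d\times n}$ the rows are split in the same way (first $k$ and last $d-k$ rows) and the $n$ columns are split into two consecutive groups; $\hat C$ is then simply the matrix formed by the last $d-k$ rows of $PC$ and does not depend on how the columns are split. The gradient $\nabla f$ of $f:\mathbb{R}^d\to\mathbb{R}$ is a column vector, so $\frac12\nabla|\xi(x)|^2=(x^1-b,\,0)^T$. A matrix is Hurwitz if all its eigenvalues have strictly negative real part. The processes $X^\varepsilon$ (for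 all $\varepsilon$) and $Y$ are driven by the same Brownian motion $W$. *)

(* Defs.v *)
From HB Require Import structures.
From mathcomp Require Import all_boot all_order all_algebra.
From mathcomp Require Import complex.
From mathcomp Require Import all_classical all_reals all_analysis.

Set Implicit Arguments.
Unset Strict Implicit.
Unset Printing Implicit Defensive.

Import Order.TTheory GRing.Theory Num.Theory.
Import numFieldNormedType.Exports.

Local Open Scope classical_set_scope.
Local Open Scope ring_scope.

Section linear_algebra.
Context {R : realType}.

(* The library norm on matrices is the sup norm. *)
Definition enorm m (x : 'cV[R]_m) : R := Num.sqrt (\sum_i x i ord0 ^+ 2).

Definition grad m (f : 'cV[R]_m -> R) (x : 'cV[R]_m) : 'cV[R]_m :=
  \col_i 'D_(delta_mx i ord0) f x.

(* The eigenvalues are the complex ones. *)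
Definition hurwitz m (A : 'M[R]_m) : Prop :=
  forall z : complex R,
    eigenvalue (map_mx (real_complex R) A) z -> complex.Re z < 0.

(* R^d = R^k x R^l with d = k + l; x^1 = usubmx x and x^2 = dsubmx x. *)
Definition xi k l (b : 'cV[R]_k) (x : 'cV[R]_(k + l)) : 'cV[R]_k :=
  usubmx x - b.

Definition penalized_drift k l (b : 'cV[R]_k) (M K : 'M[R]_(k + l)) (eps : R)
    (x : 'cV[R]_(k + l)) : 'cV[R]_(k + l) :=
  M *m x - (2 * eps)^-1 *: (K *m grad (fun y => enorm (xi b y) ^+ 2) x).

End linear_algebra.

Section stochastic.
Context {R : realType} {d : measure_display} {Om : measurableType d}.
Variable Pr : probability Om R.

(* A random vector is measurable for a sigma-algebra when all its coordinates
   are: the Borel sigma-algebra of R^m is generated by the coordinates. *)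
Definition measurable_for (G : set (set Om)) m (U : Om -> 'cV[R]_m) : Prop :=
  forall i (A : set R), measurable A -> G ((fun w => U w i ord0) @^-1` A).

Definition sigma_generated m (U : Om -> 'cV[R]_m) : set (set Om) :=
  <<s [set E | exists i (A : set R),
         measurable A /\ E = (fun w => U w i ord0) @^-1` A] >>.

Definition indep_sigma (G H : set (set Om)) : Prop :=
  forall A B, G A -> H B -> Pr (A `&` B) = (Pr A * Pr B)%E.

Definition cvg_in_probability (I : Type) m (U : I -> Om -> 'cV[R]_m)
    (G : set_system I) (V : Om -> 'cV[R]_m) : Prop :=
  forall delta : R, 0 < delta ->
    Pr [set w | delta < enorm (U i w - V w)] @[i --> G] --> 0%E.

(* The time axis is [0, +oo[: families indexed by R are only constrained
   there. *)
Definition filtration (F : R -> set (set Om)) : Prop :=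
  [/\ forall t, 0 <= t -> sigma_algebra setT (F t),
      forall t, 0 <= t -> F t `<=` measurable
    & forall s t, 0 <= s -> s <= t -> F s `<=` F t].

Definition adapted (F : R -> set (set Om)) m (U : R -> Om -> 'cV[R]_m) : Prop :=
  forall t, 0 <= t -> measurable_for (F t) (U t).

Definition continuous_paths m (U : R -> Om -> 'cV[R]_m) : Prop :=
  {ae Pr, forall w, {within `[0%R, +oo[, continuous (fun t : R => U t w)}}.

(* Law N(0, v I_m), v > 0; the second parameter of [normal_prob] is the
   standard deviation. *)
Definition centered_gaussian m (v : R) (U : Om -> 'cV[R]_m) : Prop :=
  forall A : 'I_m -> set R, (forall i, measurable (A i)) ->
    Pr [set w | forall i, A i (U w i ord0)] =
    (\prod_(i < m) normal_prob 0 (Num.sqrt v) (A i))%E.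

Definition brownian_motion (F : R -> set (set Om)) n
    (W : R -> Om -> 'cV[R]_n) : Prop :=
  [/\ adapted F W,
      continuous_paths W,
      {ae Pr, forall w, W 0 w = 0},
      forall s t, 0 <= s -> s < t ->
        centered_gaussian (t - s) (fun w => W t w - W s w)
    & forall s t, 0 <= s -> s < t ->
        indep_sigma (F s) (sigma_generated (fun w => W t w - W s w))].

(* dU_t = beta_t dt + S dW_t. As S is constant and deterministic, the Ito
   integral of S over [0, t] is S (W_t - W_0). The Lebesgue integral is real
   valued with a default value outside of integrable functions; all drifts
   below have continuous paths. *)
Definition ito_eq n (W : R -> Om -> 'cV[R]_n) m (beta : R -> Om -> 'cV[R]_m)
    (S : 'M[R]_(m, n)) (U : R -> Om -> 'cV[R]_m) : Prop :=
  {ae Pr, forall w, forall t, 0 <= t ->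
     U t w = U 0 w
           + \col_i (\int[lebesgue_measure]_(s in `[0%R, t]) beta s w i ord0)%R
           + S *m (W t w - W 0 w)}.

(* Strong solution of dU_t = f(U_t) dt + S dW_t, U_0 = U0. *)
Definition sde_solution (F : R -> set (set Om)) n (W : R -> Om -> 'cV[R]_n) m
    (f : 'cV[R]_m -> 'cV[R]_m) (S : 'M[R]_(m, n)) (U0 : Om -> 'cV[R]_m)
    (U : R -> Om -> 'cV[R]_m) : Prop :=
  [/\ adapted F U,
      continuous_paths U,
      {ae Pr, forall w, U 0 w = U0 w}
    & ito_eq W (fun t w => f (U t w)) S U].

End stochastic.

(* Main.v *)
Require Import Defs.
From HB Require Import structures.
From mathcomp Require Import all_boot all_order all_algebra.
From mathcomp Require Import spectral complex ring lra.
From mathcomp Require Import all_classical all_reals all_analysis.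
From mathcomp Require Import measurable_realfun.

Set Implicit Arguments.
Unset Strict Implicit.
Unset Printing Implicit Defensive.

Import Order.TTheory GRing.Theory Num.Theory.
Import numFieldNormedType.Exports.

Local Open Scope classical_set_scope.
Local Open Scope ring_scope.

(** The noise enters with a constant coefficient, so the equations can be
    solved path by path: for a fixed continuous noise path [w] they are
    integral equations without any stochastic integral, and the convergence is
    deterministic ([pathwise_limit]).  Probability enters only in the passage
    from paths to convergence in probability
    ([cvg_in_probability_of_paths]).

    Let N = (alpha I) be the lower block row of P, and put U = X^1 - b and
    D = N (X - Y).  The choice of alpha means exactly N K (u, 0)^T = 0 for
    every u, hence the stiff term is invisible in D; moreover N P = N, hence
    the noise cancels in D.  Thus D is continuously differentiable with
    D' = N M (X - Y), and X - Y is a linear function of (U, D) because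
    Y^1 = b.  What remains is to show that U tends to 0 at every positive
    time, although it may start away from 0.

    The fast variable satisfies dU = (M X)^1 dt - K11 U dt / eps + dB, where B
    is a merely continuous path.  As - K11 is Hurwitz there is a quadratic form
    q with q' <= - c |U|^2 / eps along the stiff part ([lyapunov]).  To
    differentiate q, the path B is replaced by a smooth path g at distance at
    most sqrt(delta) from it ([vsmooth_approximation]): U - (B - g) is
    differentiable, and the replacement perturbs the stiff term by at most a
    multiple of sqrt(delta) / eps, which has the same order in eps as the
    dissipation and so costs only O(delta).  The energy |D|^2 + lambda eps q
    then satisfies a Gronwall inequality uniform in eps, which makes D small;
    with D under control, q itself relaxes at rate 1 / eps and is small at
    every fixed positive time.  The outcome is [energy_estimate]: at time T
    both quantities are bounded by a constant, independent of eps and of the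
    smoothing, times
    |D(0)|^2 + eps |U(0)|^2 + delta + eps kappa, where kappa depends on delta.
    Choosing delta first and then eps gives the pathwise limit.

    For the convergence in probability, suppose that the probability of a
    deviation of X from Y does not tend to 0.  Then there are eps_n -> 0 along
    which it stays bounded below while the initial data converge so fast that
    the Borel-Cantelli lemma applies.  Almost surely the initial data then
    converge along the sequence, hence so do the solutions; so the limsup of
    the deviation events is null, against the lower bound.  Passing to
    sequences also makes the exceptional null sets, which depend on eps,
    countable in number.

    The remaining assertions follow by reading P M and P C in block form. *)

(** * Euclidean geometry of column vectors *)

Section euclid.
Context {R : realType}.

Definition dot m (u v : 'cV[R]_m) : R := \sum_i u i ord0 * v i ord0.

Definition nsq m (u : 'cV[R]_m) : R := dot u u.

Lemma dotE m (u v : 'cV[R]_m) : dot u v = (u^T *m v) ord0 ord0.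
Proof. by rewrite mxE; apply: eq_bigr => i _; rewrite mxE. Qed.

Lemma dotC m (u v : 'cV[R]_m) : dot u v = dot v u.
Proof. by apply: eq_bigr => i _; rewrite mulrC. Qed.

Lemma dotDl m (u v w : 'cV[R]_m) : dot (u + v) w = dot u w + dot v w.
Proof. by rewrite -big_split; apply: eq_bigr => i _; rewrite mxE mulrDl. Qed.

Lemma dotDr m (u v w : 'cV[R]_m) : dot u (v + w) = dot u v + dot u w.
Proof. by rewrite dotC dotDl !(dotC u). Qed.

Lemma dotZl m a (u v : 'cV[R]_m) : dot (a *: u) v = a * dot u v.
Proof. by rewrite mulr_sumr; apply: eq_bigr => i _; rewrite mxE mulrA. Qed.

Lemma dotZr m a (u v : 'cV[R]_m) : dot u (a *: v) = a * dot u v.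
Proof. by rewrite dotC dotZl dotC. Qed.

Lemma dotNr m (u v : 'cV[R]_m) : dot u (- v) = - dot u v.
Proof. by rewrite -scaleN1r dotZr mulN1r. Qed.

Lemma dot_mull m n (N : 'M[R]_(n, m)) u v : dot (N *m u) v = dot u (N^T *m v).
Proof. by rewrite !dotE trmx_mul mulmxA. Qed.

Lemma nsq_ge0 m (u : 'cV[R]_m) : 0 <= nsq u.
Proof. by apply: sumr_ge0 => i _; rewrite -expr2 sqr_ge0. Qed.

Lemma nsqZ m a (u : 'cV[R]_m) : nsq (a *: u) = a ^+ 2 * nsq u.
Proof. by rewrite /nsq dotZl dotZr mulrA -expr2. Qed.

Lemma nsqN m (u : 'cV[R]_m) : nsq (- u) = nsq u.
Proof. by rewrite -scaleN1r nsqZ sqrrN expr1n mul1r. Qed.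

Lemma nsqD_le m (u v : 'cV[R]_m) : nsq (u + v) <= 2 * nsq u + 2 * nsq v.
Proof.
have := nsq_ge0 (u - v).
rewrite /nsq !(dotDl, dotDr) -scaleN1r !(dotZl, dotZr) (dotC v u); lra.
Qed.

Lemma nsq_coord m (u : 'cV[R]_m) i : u i ord0 ^+ 2 <= nsq u.
Proof.
rewrite /nsq /dot (bigD1 i)//= -expr2 lerDl sumr_ge0// => j _.
by rewrite -expr2 sqr_ge0.
Qed.

Lemma nsq_eq0 m (u : 'cV[R]_m) : nsq u = 0 -> u = 0.
Proof.
move=> u0; apply/colP => i; rewrite mxE.
have := nsq_coord u i; rewrite u0 => ui.
by apply/eqP; rewrite -sqrf_eq0 eq_le ui sqr_ge0.
Qed.

Lemma enorm_sqr m (u : 'cV[R]_m) : enorm u ^+ 2 = nsq u.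
Proof.
rewrite /enorm sqr_sqrtr; first by apply: eq_bigr => i _; rewrite expr2.
by apply: sumr_ge0 => i _; rewrite sqr_ge0.
Qed.

Lemma enorm_ge0 m (u : 'cV[R]_m) : 0 <= enorm u.
Proof. exact: sqrtr_ge0. Qed.

(** The free weight lets cross terms be absorbed in a dissipation term. *)
Lemma dot_young m (u v : 'cV[R]_m) eta : 0 < eta ->
  2 * dot u v <= eta * nsq u + eta^-1 * nsq v.
Proof.
move=> eta0; have := nsq_ge0 (eta *: u - v).
rewrite /nsq !(dotDl, dotDr) -scaleN1r !(dotZl, dotZr) (dotC v u) => h.
rewrite -(ler_pM2l eta0) mulrDr mulVKf ?gt_eqF// -/(nsq u) -/(nsq v).
move: h; rewrite -/(nsq u) -/(nsq v); lra.
Qed.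

Lemma dot_sqr_le m (u v : 'cV[R]_m) : dot u v ^+ 2 <= nsq u * nsq v.
Proof.
have [v0|v0] := eqVneq (nsq v) 0.
  rewrite (nsq_eq0 v0) /nsq /dot.
  rewrite [X in X ^+ 2]big1 => [|i _]; last by rewrite mxE mulr0.
  by rewrite expr0n/= [X in _ * X]big1 ?mulr0// => i _; rewrite mxE mulr0.
have vgt0 : 0 < nsq v by rewrite lt_neqAle eq_sym v0 nsq_ge0.
have := nsq_ge0 (nsq v *: u - dot u v *: v).
rewrite {1}/nsq !(dotDl, dotDr) -!scaleNr !(dotZl, dotZr) (dotC v u).
rewrite -/(nsq u) -/(nsq v) => h.
by rewrite -subr_ge0 -(pmulr_rge0 _ vgt0); move: h; lra.
Qed.

Lemma nsq_mulmx m n (N : 'M[R]_(n, m)) :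
  exists2 c, 0 < c & forall u, nsq (N *m u) <= c * nsq u.
Proof.
exists (1 + \sum_i nsq (row i N)^T) => [|u].
  by rewrite ltr_wpDr// sumr_ge0// => i _; exact: nsq_ge0.
rewrite mulrDl mul1r mulr_suml ler_wpDl ?nsq_ge0//.
apply: ler_sum => i _; rewrite -expr2.
suff -> : (N *m u) i ord0 = dot (row i N)^T u by exact: dot_sqr_le.
by rewrite mxE; apply: eq_bigr => j _; rewrite !mxE.
Qed.

End euclid.

(** * Lyapunov functions of Hurwitz matrices *)

Section lyapunov.
Context {R : realType}.
Local Notation C := (complex R).

Let reM m n (M : 'M[C]_(m, n)) : 'M[R]_(m, n) := map_mx (@complex.Re R) M.
Let imM m n (M : 'M[C]_(m, n)) : 'M[R]_(m, n) := map_mx (@complex.Im R) M.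

Let ReD (x y : C) : complex.Re (x + y) = complex.Re x + complex.Re y.
Proof. by case: x y => [? ?] []. Qed.

Let ImD (x y : C) : complex.Im (x + y) = complex.Im x + complex.Im y.
Proof. by case: x y => [? ?] []. Qed.

Let ReM (x y : C) : complex.Re (x * y) =
  complex.Re x * complex.Re y - complex.Im x * complex.Im y.
Proof. by case: x y => [? ?] []. Qed.

Let ImM (x y : C) : complex.Im (x * y) =
  complex.Re x * complex.Im y + complex.Im x * complex.Re y.
Proof. by case: x y => [? ?] []. Qed.

Let reM_mul m n p (M : 'M[C]_(m, n)) (N : 'M[C]_(n, p)) :
  reM (M *m N) = reM M *m reM N - imM M *m imM N.
Proof.
apply/matrixP => i j; rewrite !mxE -sumrB (big_morph _ ReD (erefl _)).
by apply: eq_bigr => s _; rewrite !mxE ReM.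
Qed.

Let imM_mul m n p (M : 'M[C]_(m, n)) (N : 'M[C]_(n, p)) :
  imM (M *m N) = reM M *m imM N + imM M *m reM N.
Proof.
apply/matrixP => i j; rewrite !mxE -big_split (big_morph _ ImD (erefl _)).
by apply: eq_bigr => s _; rewrite !mxE ImM.
Qed.

Let reM_real m n (M : 'M[R]_(m, n)) : reM (map_mx (real_complex R) M) = M.
Proof. by apply/matrixP => i j; rewrite !mxE. Qed.

Let imM_real m n (M : 'M[R]_(m, n)) : imM (map_mx (real_complex R) M) = 0.
Proof. by apply/matrixP => i j; rewrite !mxE. Qed.

(** Schur triangularisation of the complexified matrix: the diagonal of the
    triangular form consists of eigenvalues, to which the Hurwitz condition
    applies. *)
Lemma hurwitz_triangular k (A : 'M[R]_k) : (0 < k)%N -> hurwitz (- A) ->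
  exists P : 'M[C]_k, exists T : 'M[C]_k,
    [/\ P \in unitmx, P *m map_mx (real_complex R) A = T *m P,
        is_trig_mx T & forall i, 0 < complex.Re (T i i)].
Proof.
move=> k0 hA; set Ac := map_mx _ _.
have [P Pu] := Schur Ac k0.
have Pun := unitarymx_unit Pu.
rewrite /similar_to/= conjumx// => Tt.
exists P, (P *m Ac *m invmx P); split => //; first by rewrite mulmxKV.
move=> i; set T := P *m _ *m _ in Tt *.
have eT : eigenvalue T (T i i).
  rewrite eigenvalue_root_char char_poly_trig// /root horner_prod.
  by rewrite (bigD1 i)//= !hornerE subrr mul0r.
have eA : eigenvalue Ac (T i i).
  have TE : T = conjmx P Ac by rewrite conjumx.
  apply: (@eigenvalue_conjmx _ _ _ P Ac).
  - exact: stablemx_unit.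
  - by rewrite row_free_unit.
  - by rewrite -TE.
have : eigenvalue (map_mx (real_complex R) (- A)) (- T i i).
  have /eigenvalueP[v vA v0] := eA; apply/eigenvalueP; exists v => //.
  by rewrite map_mxN mulmxN vA scaleNr.
move/hA; case: (T i i) => a c /=; by rewrite oppr_lt0.
Qed.

(** Conjugating a lower triangular matrix by diag(del^i) multiplies the entry
    (i, j) by del^(i - j): the diagonal is unchanged and the rest becomes
    arbitrarily small. *)
Lemma triangular_scaling k (A P T : 'M[C]_k) (m eta : R) :
  P \in unitmx -> P *m A = T *m P -> is_trig_mx T -> 0 < eta ->
  (forall i, m <= complex.Re (T i i)) ->
  exists P' : 'M[C]_k, exists T' : 'M[C]_k,
    [/\ P' \in unitmx, P' *m A = T' *m P',
        forall i, m <= complex.Re (T' i i)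
      & forall i j, i != j ->
          `|complex.Re (T' i j)| <= eta /\ `|complex.Im (T' i j)| <= eta].
Proof.
move=> Pu PA Tt eta0 mT.
pose L := 1 + \sum_i \sum_j (`|complex.Re (T i j)| + `|complex.Im (T i j)|).
have L1 : 1 <= L.
  by rewrite lerDl; do 2 (apply: sumr_ge0 => ? _); rewrite addr_ge0.
have TL i j : `|complex.Re (T i j)| + `|complex.Im (T i j)| <= L.
  rewrite /L (bigD1 i)//= (bigD1 j)//= ler_wpDl// 2?ler_wpDr//.
    by do 2 (apply: sumr_ge0 => ? _); rewrite addr_ge0.
  by apply: sumr_ge0 => ? _; rewrite addr_ge0.
pose del := Num.min 1 (eta / L).
have del0 : 0 < del by rewrite lt_min ltr01 divr_gt0// (lt_le_trans _ L1).
have delL : del * L <= eta.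
  by rewrite -ler_pdivlMr ?(lt_le_trans _ L1)// ge_min lexx orbT.
have del1 : del <= 1 by rewrite ge_min lexx.
pose D : 'M[C]_k := diag_mx (\row_i real_complex R (del ^+ i)).
pose D' : 'M[C]_k := diag_mx (\row_i real_complex R (del ^- i)).
have DD' : D' *m D = 1%:M.
  rewrite /D /D' mulmx_diag; apply/matrixP => r s; rewrite !mxE.
  congr (_ *+ _); rewrite -rmorphM/= mulVf ?rmorph1//.
  by rewrite expf_neq0// gt_eqF.
have Du : D \in unitmx by case: (mulmx1_unit DD').
have T'E i j : (D *m T *m D') i j =
    real_complex R (del ^+ i * del ^- j) * T i j.
  rewrite mul_mx_diag mxE mul_diag_mx !mxE rmorphM/=.
  by rewrite mulrAC.
exists (D *m P), (D *m T *m D'); split.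
- by rewrite unitmx_mul Du.
- by rewrite -mulmxA PA !mulmxA -(mulmxA _ D') DD' mulmx1.
- by move=> i; rewrite T'E mulfV ?expf_neq0 ?gt_eqF// rmorph1 mul1r.
move=> i j ij; rewrite T'E.
have [lij|lji] := ltnP i j.
  by rewrite (is_trig_mxP _ _ _ _)// mulr0/= normr0 ltW.
have {}ij : (j < i)%N by rewrite ltn_neqAle lji andbT eq_sym.
have -> : del ^+ i * del ^- j = del * del ^+ (i - j).-1.
  rewrite -exprS prednK ?subn_gt0// expfB//.
set f := del * _.
have f0 : 0 <= f by rewrite mulr_ge0 ?exprn_ge0// ltW.
have fdel : f <= del.
  by rewrite -[leRHS]mulr1 ler_wpM2l ?(ltW del0)// exprn_ile1// ltW.
clearbody f.
have main x : 0 <= x -> x <= L -> f * x <= eta.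
  move=> x0 xL; apply: le_trans delL; exact: ler_pM.
have := TL i j; rewrite !(ReM, ImM)/= !mul0r subr0 addr0 !normrM (ger0_norm f0).
move=> h; split; apply: main => //; apply: le_trans h.
  by rewrite lerDl.
by rewrite lerDr.
Qed.

(** With z = p + i q the right hand side is Re <z, (T1 + i T2) z>, to which the
    imaginary parts of the diagonal entries do not contribute; each of the other
    k^2 terms costs at most eta times the squared moduli of two coordinates. *)
Lemma near_diagonal_coercive k (T1 T2 : 'M[R]_k) (m eta : R) (p q : 'cV[R]_k) :
  (forall i, m <= T1 i i) ->
  (forall i j, i != j -> `|T1 i j| <= eta /\ `|T2 i j| <= eta) ->
  0 <= eta ->
  (m - 2 * k%:R * eta) * (nsq p + nsq q) <=
  dot p (T1 *m p - T2 *m q) + dot q (T1 *m q + T2 *m p).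
Proof.
move=> mT Teta eta0; pose s i := p i ord0 ^+ 2 + q i ord0 ^+ 2.
have s0 i : 0 <= s i by rewrite addr_ge0 ?sqr_ge0.
have sE : nsq p + nsq q = \sum_i s i.
  by rewrite -big_split; apply: eq_bigr => i _; rewrite /s !expr2.
pose t i j := T1 i j * (p i ord0 * p j ord0 + q i ord0 * q j ord0)
  + T2 i j * (q i ord0 * p j ord0 - p i ord0 * q j ord0).
have -> : dot p (T1 *m p - T2 *m q) + dot q (T1 *m q + T2 *m p) =
    \sum_i \sum_j t i j.
  rewrite -big_split; apply: eq_bigr => i _ /=; rewrite !mxE.
  rewrite -sumrB -big_split /= !mulr_sumr -big_split; apply: eq_bigr => j _ /=.
  by rewrite /t; ring.
have tge i j : (if i == j then m * s i else 0) - eta * (s i + s j) <= t i j.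
  have [<-|ij] := eqVneq i j.
    have h := ler_wpM2r (s0 i) (mT i).
    have := mulr_ge0 eta0 (s0 i); move: h; rewrite /t /s; nra.
  have [/ler_normlP[h1 h2] /ler_normlP[h3 h4]] := Teta _ _ ij.
  rewrite sub0r /t /s.
  move: (p i ord0) (p j ord0) (q i ord0) (q j ord0) => a b c d.
  (* (eta - x) (y - z)^2 + (eta + x) (y + z)^2 is nonnegative. *)
  have key x y z : - x <= eta -> x <= eta ->
      - (eta * (y ^+ 2 + z ^+ 2) / 2) <= x * (y * z).
    move=> xl xu.
    have h5 : 0 <= (eta - x) * (y - z) ^+ 2 by rewrite mulr_ge0 ?sqr_ge0 ?subr_ge0.
    have h6 : 0 <= (eta + x) * (y + z) ^+ 2.
      by rewrite mulr_ge0 ?sqr_ge0// -lerBlDr sub0r.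
    nra.
  have := key _ a b h1 h2; have := key _ c d h1 h2; have := key _ c b h3 h4.
  have : - - T2 i j <= eta by rewrite opprK.
  move=> h5; have := key _ a d h5 h3; lra.
apply: le_trans (ler_sum _ (fun i _ => ler_sum _ (fun j _ => tge i j))).
rewrite sE; clearbody s; rewrite le_eqVlt; apply/orP; left; apply/eqP.
under [RHS]eq_bigr => i _.
  rewrite sumrB -big_mkcond/= (big_pred1 i) => [|j]; last by rewrite eq_sym.
  rewrite -mulr_sumr big_split/= sumr_const card_ord -mulr_natl.
  over.
rewrite sumrB -mulr_sumr -mulr_sumr big_split/= -mulr_sumr.
rewrite sumr_const card_ord -mulr_natl; ring.
Qed.

(** In a basis in which the complexified A is nearly diagonal, the hermitian
    norm |P u|^2 decreases along u' = - A u.  Q is the real part P1^T P1 +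
    P2^T P2 of its Gram matrix, so it is real and symmetric although P = P1 + i
    P2 is complex. *)
Theorem lyapunov k (A : 'M[R]_k) : (0 < k)%N -> hurwitz (- A) ->
  exists Q : 'M[R]_k, exists2 c : R, 0 < c &
    [/\ Q^T = Q, forall u, c * nsq u <= dot u (Q *m u)
      & forall u, c * nsq u <= dot u (Q *m (A *m u))].
Proof.
move=> k0 hA; have [P0 [T0 [P0u P0A T0t T0pos]]] := hurwitz_triangular k0 hA.
pose m := \big[Num.min/1]_i complex.Re (T0 i i).
have m0 : 0 < m by apply: lt_bigmin.
have mT0 i : m <= complex.Re (T0 i i) by exact: bigmin_le_cond.
have kpos : 0 < k%:R :> R by rewrite ltr0n.
pose eta := m / (4 * k%:R).
have eta0 : 0 < eta by rewrite divr_gt0// mulr_gt0.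
have [P [T [Pu PA mT Teta]]] := triangular_scaling P0u P0A T0t eta0 mT0.
have := congr1 (@reM _ _) PA; have := congr1 (@imM _ _) PA.
rewrite !reM_mul !imM_mul reM_real imM_real !mulmx0 subr0 add0r.
set P1 := reM P; set P2 := imM P; set T1 := reM T; set T2 := imM T => P2A P1A.
pose Q := P1^T *m P1 + P2^T *m P2.
have QE u v : dot u (Q *m v) = dot (P1 *m u) (P1 *m v) + dot (P2 *m u) (P2 *m v).
  by rewrite mulmxDl dotDr !dot_mull !mulmxA.
have := congr1 (@reM _ _) (mulVmx Pu); rewrite reM_mul -/P1 -/P2.
have -> : reM (1%:M : 'M[C]_k) = 1%:M.
  by apply/matrixP => i j; rewrite !mxE; case: (i == j).
set R1 := reM _; set R2 := imM _ => RP.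
have [c1 c10 hc1] := nsq_mulmx R1; have [c2 c20 hc2] := nsq_mulmx R2.
have Pbound u : nsq u <= (2 * (c1 + c2)) * (nsq (P1 *m u) + nsq (P2 *m u)).
  have -> : nsq u = nsq (R1 *m (P1 *m u) - R2 *m (P2 *m u)).
    by rewrite !mulmxA -mulmxBl RP mul1mx.
  apply: le_trans (nsqD_le _ _) _; rewrite nsqN.
  have := hc1 (P1 *m u); have := hc2 (P2 *m u).
  have := mulr_ge0 (ltW c10) (nsq_ge0 (P2 *m u)).
  have := mulr_ge0 (ltW c20) (nsq_ge0 (P1 *m u)).
  lra.
pose cc := 2 * (c1 + c2).
have cc0 : 0 < cc by rewrite mulr_gt0// addr_gt0.
exists Q, (Num.min 1 (m / 2) / cc).
  by rewrite divr_gt0// lt_min ltr01 divr_gt0.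
have lower u (x : R) : Num.min 1 (m / 2) * (nsq (P1 *m u) + nsq (P2 *m u)) <= x ->
    Num.min 1 (m / 2) / cc * nsq u <= x.
  apply: le_trans; rewrite -mulrA ler_wpM2l//.
    by rewrite le_min ler01 divr_ge0// ltW.
  by rewrite mulrC ler_pdivrMr// mulrC Pbound.
split.
- by rewrite /Q linearD/= !trmx_mul !trmxK.
- move=> u; apply: lower; rewrite QE -/(nsq _) -/(nsq _).
  by rewrite -[leRHS]mul1r ler_wpM2r ?addr_ge0 ?nsq_ge0// ge_min lexx.
- move=> u; apply: lower; rewrite QE !mulmxA P1A P2A mulmxBl mulmxDl -!mulmxA.
  apply: le_trans (near_diagonal_coercive _ _ _ _ (ltW eta0)); last 2 first.
  - by move=> i; rewrite mxE.
  - by move=> i j ij; rewrite !mxE; exact: Teta.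
  rewrite ler_wpM2r ?addr_ge0 ?nsq_ge0//.
  have -> : m - 2 * k%:R * eta = m / 2.
    by rewrite /eta; field; rewrite gt_eqF.
  by rewrite ge_min lexx orbT.
Qed.

End lyapunov.

(** * Calculus on the half line *)

Section calculus.
Context {R : realType}.

Definition vderive m (U : R -> 'cV[R]_m) (t : R) (v : 'cV[R]_m) :=
  forall i, is_derive t (1 : R) (fun s => U s i ord0) (v i ord0).

Lemma vderiveD m (U V : R -> 'cV[R]_m) t u v :
  vderive U t u -> vderive V t v -> vderive (fun s => U s + V s) t (u + v).
Proof.
move=> dU dV i; rewrite mxE.
have -> : (fun s => (U s + V s) i ord0) =
    (fun s => U s i ord0) + (fun s => V s i ord0).
  by apply/funext => s; rewrite mxE.
exact: is_deriveD.
Qed.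

Lemma vderive_cst m (a : 'cV[R]_m) t : vderive (fun _ => a) t 0.
Proof. by move=> i; rewrite mxE; exact: is_derive_cst. Qed.

Lemma vderive_mulmx m n (N : 'M[R]_(n, m)) (U : R -> 'cV[R]_m) t u :
  vderive U t u -> vderive (fun s => N *m U s) t (N *m u).
Proof.
move=> dU i; rewrite mxE.
have -> : (fun s => (N *m U s) i ord0) =
    \sum_j (N i j *: (fun s => U s j ord0)).
  by apply/funext => s; rewrite mxE fct_sumE.
by apply: is_derive_sum => j; exact: is_deriveZ.
Qed.

Lemma vderiveN m (U : R -> 'cV[R]_m) t u :
  vderive U t u -> vderive (fun s => - U s) t (- u).
Proof.
move=> dU i; rewrite mxE.
have -> : (fun s => (- U s) i ord0) = - (fun s => U s i ord0).
  by apply/funext => s; rewrite mxE.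
exact: is_deriveN.
Qed.

Lemma vderiveB m (U V : R -> 'cV[R]_m) t u v :
  vderive U t u -> vderive V t v -> vderive (fun s => U s - V s) t (u - v).
Proof. by move=> dU dV; apply: vderiveD => //; exact: vderiveN. Qed.

Lemma is_derive_dot m (U V : R -> 'cV[R]_m) t u v :
  vderive U t u -> vderive V t v ->
  is_derive t (1 : R) (fun s => dot (U s) (V s)) (dot (U t) v + dot u (V t)).
Proof.
move=> dU dV.
have -> : (fun s => dot (U s) (V s)) =
    \sum_i ((fun s => U s i ord0) * (fun s => V s i ord0)).
  by apply/funext => s; rewrite fct_sumE.
have -> : dot (U t) v + dot u (V t) =
    \sum_i (U t i ord0 *: v i ord0 + V t i ord0 *: u i ord0).
  rewrite big_split/=; congr (_ + _).
  by apply: eq_bigr => i _; rewrite mulrC.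
by apply: is_derive_sum => i; exact: is_deriveM.
Qed.

Lemma vderive_usubmx m n (U : R -> 'cV[R]_(m + n)) t u :
  vderive U t u -> vderive (fun s => usubmx (U s)) t (usubmx u).
Proof.
move=> dU i; rewrite mxE.
by under eq_fun do rewrite mxE; exact: dU.
Qed.

(** The sign of a is free: the lemma serves for exponential growth (a < 0) and
    for relaxation (a > 0).  It holds because expR (a t) (h t - c / a) is
    nonincreasing. *)
Lemma gronwall (h dh : R -> R) (a c T : R) : a != 0 ->
  (forall t : R, 0 <= t <= T -> is_derive t 1 h (dh t)) ->
  (forall t : R, 0 <= t <= T -> dh t <= - a * h t + c) ->
  forall t : R, 0 <= t <= T -> h t <= expR (- (a * t)) * (h 0 - c / a) + c / a.
Proof.
move=> a0 dhP hle t /andP[t0 tT].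
pose phi s := expR (a * s) * (h s - c / a).
have dphi (s : R) : 0 <= s <= T -> is_derive s 1 phi
    (expR (a * s) * (a * (h s - c / a) + dh s)).
  move=> sT; have dhs := dhP _ sT.
  have -> : phi = ((expR \o ( *%R a)) * (h - cst (c / a))) by [].
  have da : is_derive s 1 ( *%R a) a.
    have -> : *%R a = a *: (id : R -> R) by [].
    by apply: is_derive_eq; rewrite [_ *: _]mulr1.
  apply: is_derive_eq.
  rewrite -[LHS]/(expR (a * s) * (dh s - 0) + (h s - c / a) * (expR (a * s) * a)).
  ring.
have phi_le : phi t <= phi 0.
  have cphi : {within `[0, T], continuous phi}.
    apply: derivable_within_continuous => s; rewrite in_itv/= => sT.
    by have [] := dphi _ sT.
  have T0 := le_trans t0 tT.
  apply: (@ler0_derive1_le_cc _ phi 0 T) => //; rewrite ?in_itv/= ?t0 ?lexx//.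
    move=> s; rewrite in_itv/= => /andP[s0 sT].
    by have [|] := dphi s; rewrite ?(ltW s0) ?(ltW sT).
  move=> s; rewrite in_itv/= => /andP[s0 sT].
  have sI : 0 <= s <= T by rewrite !ltW.
  have := dphi _ sI => dps; rewrite derive1E derive_val.
  rewrite pmulr_rle0 ?expR_gt0// mulrBr mulrCA mulfV// mulr1.
  have := hle _ sI; lra.
move: phi_le; rewrite /phi mulr0 expR0 mul1r => phi_le.
rewrite -lerBlDr expRN -(ler_pM2l (expR_gt0 (a * t))).
by rewrite mulVKf// gt_eqF// expR_gt0.
Qed.

(** Freezing a path at its initial value for negative times turns continuity on
    the closed half line into continuity on the whole line. *)
Lemma continuous_clamp (f : R -> R) : {within `[0, +oo[, continuous f} ->
  continuous (fun s : R => f (Num.max s 0)).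
Proof.
move=> /subspace_continuousP cf x.
have cmax : {for x, continuous (fun s : R => Num.max s 0)}.
  by apply: continuous_max => //; exact: cst_continuous.
have Ax s : `[0, +oo[%classic (Num.max s 0 : R).
  by rewrite /= in_itv/= andbT le_max lexx orbT.
have := cf _ (Ax x); apply: cvg_trans => A /= fA.
exact: (@filterS _ (nbhs x) _ _ _ (fun s h => h (Ax s)) (cmax _ fA)).
Qed.

(** The integral from 0 has no two-sided derivative at 0.  Integrating the
    frozen path from -1 gives a primitive that is differentiable at 0 as well,
    so no one-sided derivatives are needed afterwards. *)
Lemma primitive_halfline (f : R -> R) : {within `[0, +oo[, continuous f} ->
  exists J : R -> R,
    (forall t : R, 0 <= t -> is_derive t (1 : R) J (f t)) /\
    (forall t : R, 0 <= t -> (\int[lebesgue_measure]_(s in `[0%R, t]) f s)%R = J t).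
Proof.
move=> cf; pose g (s : R) := f (Num.max s 0).
have cg : continuous g := continuous_clamp cf.
have ig a b : lebesgue_measure.-integrable `[a, b] (EFin \o g).
  apply: continuous_compact_integrable; first exact: segment_compact.
  exact: continuous_subspaceT.
pose G (t : R) := (\int[lebesgue_measure]_(s in `[(-1)%R, t]) g s)%R.
have dG (t : R) : 0 <= t -> is_derive t 1 G (f t).
  move=> t0; have t1 : -1 < t by lra.
  have tt : t < t + 1 by lra.
  have [dG G'] := continuous_FTC1_closed tt (ig _ _) t1 (cg t).
  split => //; rewrite -derive1E [LHS]G' /g.
  by rewrite max_l.
exists (fun t => G t - G 0); split=> [t t0|t t0].
  have -> : (fun t => G t - G 0) = G - cst (G 0) by [].
  have := dG _ t0 => dGt; apply: is_derive_eq; by rewrite subr0.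
rewrite [RHS](@Rintegral_itvB _ g (BLeft (-1)) (BRight t) 0)//; last first.
  by rewrite bnd_simp; lra.
rewrite Rintegral_itv_obnd_cbnd//; last first.
  have := ig 0 t; apply: integrableS => //.
  by apply: subset_itvr; rewrite bnd_simp.
apply: eq_Rintegral => s; rewrite inE/= in_itv/= => /andP[s0 _].
by rewrite /g max_l.
Qed.

Lemma vprimitive_halfline m (f : R -> 'cV[R]_m) :
  (forall i, {within `[0, +oo[, continuous (fun s => f s i ord0)}) ->
  exists J : R -> 'cV[R]_m,
    (forall t : R, 0 <= t -> vderive J t (f t)) /\
    (forall t : R, 0 <= t ->
       \col_i (\int[lebesgue_measure]_(s in `[0%R, t]) f s i ord0)%R = J t).
Proof.
move=> cf; have /choice[J JP] := fun i => primitive_halfline (cf i).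
exists (fun t => \col_i J i t); split=> t t0.
  move=> i; have -> : (fun s => (\col_i J i s) i ord0) = J i.
    by apply/funext => s; rewrite mxE.
  exact: (JP i).1.
by apply/colP => i; rewrite !mxE (JP i).2.
Qed.

(** Uniform continuity on [0, T], by compactness, in a form where the second
    point may lie beyond T. *)
Lemma continuous_right_oscillation (f : R -> R) (T delta : R) :
  continuous f -> 0 < delta ->
  exists2 eta, 0 < eta &
    forall t c : R, 0 <= t <= T -> t <= c <= t + eta -> `|f t - f c| <= delta.
Proof.
move=> cf d0.
have /compact_near_coveringP/near_covering_withinP cpt := @segment_compact R 0 T.
pose P (eta t : R) := forall c, t <= c <= t + eta -> `|f t - f c| <= delta.
have : \forall eta \near (0 : R)^'+, `[0, T]%classic `<=` P eta.
  apply: cpt => x _; have d2 : 0 < delta / 2 by lra.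
  have /cvgrPdist_le /(_ _ d2)/nbhs_ballP[r /= r0 fr] := cf x.
  have r2 : 0 < r / 2 by lra.
  exists (ball x (r / 2), [set e : R | e < r / 2]) => /=.
    split; first exact: nbhsx_ballx.
    exact: nbhs_right_lt.
  move=> [y e] [/=] xy er _ c /andP[yc ce].
  have xy' : `|x - y| < r / 2 by [].
  have h1 : `|f x - f y| <= delta / 2.
    by apply: fr => /=; rewrite /ball/= (lt_trans xy')//; lra.
  have h2 : `|f x - f c| <= delta / 2.
    apply: fr => /=; rewrite /ball/=; move: xy'.
    by rewrite !ltr_norml => /andP[? ?]; apply/andP; split; lra.
  have -> : f y - f c = (f x - f c) - (f x - f y) by ring.
  by rewrite (le_trans (ler_normB _ _))//; lra.
move=> H.
have : \forall e \near (0 : R)^'+, 0 < e /\ `[0, T]%classic `<=` P e.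
  near=> e; split; near: e; first exact: nbhs_right_gt.
  exact: H.
move=> /(@filter_ex _ _ _)[e [e0 eP]]; exists e => // t c tT; apply: eP.
by rewrite /= in_itv.
Unshelve. all: by end_near. Qed.

Lemma bounded_halfline (B : R -> R) (T : R) :
  {within `[0, +oo[, continuous B} ->
  exists M, forall t : R, 0 <= t <= T -> `|B t| <= M.
Proof.
move=> cB; pose C (s : R) := `|B (Num.max s 0)|.
have cC : {within `[0, T], continuous C}.
  apply: continuous_subspaceT => x.
  apply: (@continuous_comp _ _ _ (fun s : R => B (Num.max s 0))).
    exact: continuous_clamp.
  exact: norm_continuous.
have [T0|T0] := leP 0 T; last first.
  by exists 0 => t /andP[t0 tT]; have := le_trans t0 tT; rewrite leNgt T0.
have [c _ cP] := EVT_max T0 cC.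
exists (C c) => t /andP[t0 tT]; have := cP t.
by rewrite in_itv/= t0 tT => /(_ isT); rewrite {1}/C max_l.
Qed.

(** g t is the mean of B over [t, t + eta].  By the mean value theorem applied
    to a primitive of B it is a value of B in that window, hence close to B t;
    its derivative is a difference quotient of B, hence bounded. *)
Lemma smooth_approximation (B : R -> R) (T delta : R) :
  {within `[0, +oo[, continuous B} -> 0 <= T -> 0 < delta ->
  exists g dg : R -> R, exists kappa : R, forall t : R, 0 <= t <= T ->
    [/\ is_derive t 1 g (dg t), `|B t - g t| <= delta & `|dg t| <= kappa].
Proof.
move=> cB T0 d0; have cC := continuous_clamp cB.
have [eta eta0 etaP] := continuous_right_oscillation T cC d0.
have [G [dG _]] := primitive_halfline cB.
pose g t := eta^-1 * (G (t + eta) - G t).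
pose dg t := eta^-1 * (B (t + eta) - B t).
have dGs (t : R) : 0 <= t -> is_derive t 1 (fun s => G (s + eta)) (B (t + eta)).
  move=> t0; have -> : (fun s => G (s + eta)) = G \o (fun s => s + eta) by [].
  have t1 : 0 <= t + eta by rewrite addr_ge0// ltW.
  have := dG _ t1 => dGt.
  have ds : is_derive t 1 (fun s : R => s + eta) 1.
    have -> : (fun s : R => s + eta) = id + cst eta by [].
    by apply: is_derive_eq; rewrite addr0.
  by apply: is_derive_eq; rewrite mulr1.
have [M MP] := bounded_halfline (T + eta) cB.
exists g, dg, (eta^-1 * (2 * M)) => t /andP[t0 tT]; split.
- have -> : g = eta^-1 *: ((fun s => G (s + eta)) - G) by [].
  have := dGs _ t0; have := dG _ t0 => dGt dGst.
  exact: is_derive_eq.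
- have te : t < t + eta by rewrite ltrDl.
  have [| |c cI Gc] := @MVT _ G B t (t + eta) te.
  + move=> s; rewrite in_itv/= => /andP[ts _]; apply: dG.
    by rewrite (le_trans t0)// ltW.
  + apply: derivable_within_continuous => s; rewrite in_itv/= => /andP[ts _].
    by have /dG[] := le_trans t0 ts.
  have -> : g t = B c.
    by rewrite /g Gc; field; rewrite gt_eqF.
  move: cI; rewrite in_itv/= => /andP[tc ce].
  have := etaP t c; rewrite max_l// max_l; last by rewrite (le_trans t0)// ltW.
  by apply; rewrite ?t0 ?tT ?ltW.
- rewrite /dg normrM ger0_norm ?invr_ge0 ?(ltW eta0)//.
  rewrite ler_pM2l ?invr_gt0// (le_trans (ler_normB _ _))//.
  rewrite (_ : 2 * M = M + M); last by ring.
  by rewrite lerD// MP//; apply/andP; split; lra.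
Qed.

Lemma vsmooth_approximation m (B : R -> 'cV[R]_m) (T delta : R) :
  (forall i, {within `[0, +oo[, continuous (fun s => B s i ord0)}) ->
  0 <= T -> 0 < delta ->
  exists g dg : R -> 'cV[R]_m, exists kappa : R, forall t : R, 0 <= t <= T ->
    [/\ vderive g t (dg t), nsq (B t - g t) <= delta & nsq (dg t) <= kappa].
Proof.
move=> cB T0 d0.
pose del := Num.min 1 (delta / m.+1%:R).
have del0 : 0 < del by rewrite lt_min ltr01 divr_gt0.
have /choice[g /choice[dg /choice[kap P]]] i :=
  smooth_approximation (cB i) T0 del0.
exists (fun t => \col_i g i t), (fun t => \col_i dg i t), (\sum_i kap i ^+ 2).
move=> t tT; split.
- move=> i; rewrite mxE; under eq_fun do rewrite mxE.
  by have [] := P i t tT.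
- have -> : delta = \sum_(i < m.+1) (delta / m.+1%:R).
    by rewrite sumr_const card_ord -[RHS]mulr_natr mulfVK// pnatr_eq0.
  rewrite big_ord_recr/= ler_wpDr ?divr_ge0 ?(ltW d0)//.
  apply: ler_sum => i _; rewrite !mxE -expr2 -real_normK ?num_real//.
  have [_ h _] := P i t tT.
  apply: (@le_trans _ _ (del * 1)); last by rewrite mulr1 ge_min lexx orbT.
  rewrite expr2 ler_pM// (le_trans h)// ge_min lexx//.
- apply: ler_sum => i _; rewrite !mxE -expr2 -real_normK ?num_real//.
  have [_ _ h] := P i t tT.
  by rewrite lerXn2r// nnegrE (le_trans _ h).
Qed.

End calculus.

(** * The uniform energy estimate *)

Section energy.
Context {R : realType}.

(** U is the smoothed fast variable, r the smoothing error of the noise and f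
    collects the bounded forcing.  The point of the estimate is that C and e0
    depend neither on e nor on the forcing and the error.  The initial value of
    U, which need not be small, enters only with the factor e: in the first
    step through the weight e of q in the energy, in the second one through
    expR (- a T) <= 1 / (a T) with a of order 1 / e. *)
Lemma energy_estimate k l (A Q G1 : 'M[R]_k) (G2 : 'M[R]_(k, l))
    (N1 : 'M[R]_(l, k)) (N2 : 'M[R]_l) (c T : R) :
  Q^T = Q -> 0 < c ->
  (forall u, c * nsq u <= dot u (Q *m u)) ->
  (forall u, c * nsq u <= dot u (Q *m (A *m u))) -> 0 < T ->
  exists2 C, 0 < C & exists2 e0, 0 < e0 &
  forall (e delta kappa : R) (U r f : R -> 'cV[R]_k) (D : R -> 'cV[R]_l),
  0 < e <= e0 ->
  (forall t : R, 0 <= t <= T -> vderive U t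
     (f t + G1 *m (U t + r t) + G2 *m D t - e^-1 *: (A *m (U t + r t)))) ->
  (forall t : R, 0 <= t <= T -> vderive D t (N1 *m (U t + r t) + N2 *m D t)) ->
  (forall t : R, 0 <= t <= T -> nsq (r t) <= delta /\ nsq (f t) <= kappa) ->
  nsq (U T) + nsq (D T) <=
    C * (nsq (D 0) + e * nsq (U 0) + delta + e * kappa).
Proof.
move=> Qsym c0 Qcoer QAcoer T0.
have [bQ bQ0 hQ] := nsq_mulmx Q.
have [b1 b10 h1] := nsq_mulmx (Q *m G1).
have [b2 b20 h2] := nsq_mulmx (Q *m G2).
have [b3 b30 h3] := nsq_mulmx (Q *m A).
have [n1 n10 hN1] := nsq_mulmx N1.
have [n2 n20 hN2] := nsq_mulmx N2.
pose B := b3 / c + b1 + b2 + bQ.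
have b3c : 0 < b3 / c by rewrite divr_gt0.
have B0 : 0 < B by rewrite !addr_gt0.
pose L := 3 + n1 + n2; have L0 : 0 < L by rewrite !addr_gt0.
pose lam := 2 * L / c; have lam0 : 0 < lam by rewrite divr_gt0// mulr_gt0.
pose L' := L + lam * B.
have L'0 : 0 < L' by rewrite addr_gt0// mulr_gt0.
pose bq := 1 + bQ; have bq0 : 0 < bq by rewrite addr_gt0.
pose C1 := expR (L' * T) * (1 + lam * bq).
have C10 : 0 < C1 by rewrite mulr_gt0 ?expR_gt0// addr_gt0// mulr_gt0.
pose C2 := 2 * bq ^+ 2 / (c * T) + 2 * bq * B * (1 + C1) / c.
have C20 : 0 < C2.
  by rewrite addr_gt0// divr_gt0// ?mulr_gt0 ?exprn_gt0 ?addr_gt0.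
pose e0 := Num.min 1 (c / (2 * (4 + b1))).
have b14 : 0 < 4 + b1 by rewrite addr_gt0.
have e00 : 0 < e0 by rewrite lt_min ltr01 divr_gt0// mulr_gt0.
exists (C2 / c + C1); first by rewrite addr_gt0// divr_gt0.
exists e0 => //.
move=> e delta kappa U r f D /andP[epos ee0] dU dD rf.
have e1 : e <= 1 by rewrite (le_trans ee0)// ge_min lexx.
have e2 : e * (4 + b1) <= c / 2.
  rewrite -ler_pdivlMr//; apply: le_trans ee0 _.
  by rewrite ge_min -mulrA -invfM lexx orbT.
have T00 : 0 <= (0 : R) <= T by rewrite lexx ltW.
have TT : 0 <= T <= T by rewrite lexx ltW.
have d0 : 0 <= delta by have [h _] := rf _ T00; apply: le_trans h; exact: nsq_ge0.
have ka0 : 0 <= kappa by have [_ h] := rf _ T00; apply: le_trans h; exact: nsq_ge0.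
pose q t := dot (U t) (Q *m U t).
have q0 t : c * nsq (U t) <= q t by exact: Qcoer.
have q00 t : 0 <= q t by rewrite (le_trans _ (q0 t))// mulr_ge0 ?nsq_ge0// ltW.
have qub t : q t <= bq * nsq (U t).
  have := dot_young (U t) (Q *m U t) ltr01; have := hQ (U t).
  rewrite invr1 !mul1r -/(q t) /bq mulrDl mul1r; have := nsq_ge0 (U t).
  have := mulr_ge0 (ltW bQ0) (nsq_ge0 (U t)); lra.
(* Multiplying q' by e makes the dissipation of order one; for e <= e0 half of
   it absorbs every other term in U. *)
have [dq dqP dq_le] : exists2 dq : R -> R,
    (forall t : R, 0 <= t <= T -> is_derive t (1 : R) q (dq t)) &
    forall t : R, 0 <= t <= T -> e * dq t <=
      - (c / 2) * nsq (U t) + B * (delta + e * nsq (D t) + e * kappa).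
  pose dUt t := f t + G1 *m (U t + r t) + G2 *m D t
    - e^-1 *: (A *m (U t + r t)).
  exists (fun t => 2 * dot (U t) (Q *m dUt t)) => t tT.
    have dUT : vderive U t (dUt t) := dU _ tT.
    have := is_derive_dot dUT (vderive_mulmx Q dUT).
    have -> // : dot (U t) (Q *m dUt t) + dot (dUt t) (Q *m U t) =
      2 * dot (U t) (Q *m dUt t).
    by rewrite (dotC (dUt t)) dot_mull Qsym; ring.
  have [rd fk] := rf _ tT.
  rewrite /dUt; move: (U t) (r t) (f t) (D t) rd fk => u rr ff dd rd fk.
  rewrite !(mulmxDr, mulmxN) -!scalemxAr !(dotDr, dotNr, dotZr) !mulmxDr !dotDr.
  have y1 := dot_young u (Q *m ff) ltr01.
  have y2 := dot_young u (Q *m (G1 *m u)) ltr01.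
  have y3 := dot_young u (Q *m (G1 *m rr)) ltr01.
  have y4 := dot_young u (Q *m (G2 *m dd)) ltr01.
  have y5 := dot_young (- u) (Q *m (A *m rr)) c0.
  rewrite nsqN dotC dotNr dotC in y5.
  have z5 := QAcoer u.
  rewrite !invr1 !mul1r !mulmxA in y1 y2 y3 y4 y5 z5 *.
  have w1 := hQ ff; have w2 := h1 u; have w3 := h1 rr; have w4 := h2 dd.
  have w5 := h3 rr.
  have expand x1 x2 x3 x4 x5 x6 :
      e * (2 * (x1 + (x2 + x3) + x4 - e^-1 * (x5 + x6))) =
      e * (2 * x1) + e * (2 * x2) + e * (2 * x3) + e * (2 * x4)
        - 2 * x5 - 2 * x6.
    by field; rewrite gt_eqF.
  rewrite {}expand.
  have u0 := nsq_ge0 u.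
  have x1 : e * (2 * dot u (Q *m ff)) <= e * (nsq u + bQ * kappa).
    rewrite ler_pM2l//; apply: le_trans y1 _; rewrite lerD2l.
    by apply: le_trans w1 _; rewrite ler_pM2l.
  have x2 : e * (2 * dot u (Q *m G1 *m u)) <= e * (nsq u + b1 * nsq u).
    by rewrite ler_pM2l//; apply: le_trans y2 _; rewrite lerD2l.
  have x3 : e * (2 * dot u (Q *m G1 *m rr)) <= e * (nsq u + b1 * delta).
    rewrite ler_pM2l//; apply: le_trans y3 _; rewrite lerD2l.
    by apply: le_trans w3 _; rewrite ler_pM2l.
  have x4 : e * (2 * dot u (Q *m G2 *m dd)) <= e * (nsq u + b2 * nsq dd).
    by rewrite ler_pM2l//; apply: le_trans y4 _; rewrite lerD2l.
  have x5 : c^-1 * nsq (Q *m A *m rr) <= b3 / c * delta.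
    rewrite mulrC mulrAC ler_pM2r ?invr_gt0//.
    by apply: le_trans w5 _; rewrite ler_pM2l.
  have x6 : e * (4 + b1) * nsq u <= c / 2 * nsq u by rewrite ler_wpM2r.
  have x7 : e * (b1 * delta) <= b1 * delta.
    by rewrite -[leRHS]mul1r ler_wpM2r// mulr_ge0// ltW.
  have p1 := mulr_ge0 (ltW b3c) d0.
  have p2 := mulr_ge0 (ltW b20) d0.
  have p3 := mulr_ge0 (ltW bQ0) d0.
  have p4 : 0 <= e * nsq dd by rewrite mulr_ge0 ?nsq_ge0// ltW.
  have p5 : 0 <= e * kappa by rewrite mulr_ge0// ltW.
  have s1 := mulr_ge0 (ltW b3c) p4; have s2 := mulr_ge0 (ltW b3c) p5.
  have s3 := mulr_ge0 (ltW b10) p4; have s4 := mulr_ge0 (ltW b10) p5.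
  have s5 := mulr_ge0 (ltW b20) p5; have s6 := mulr_ge0 (ltW bQ0) p4.
  rewrite /B; move: (b3 / c) x5 p1 s1 s2 => b3' x5 p1 s1 s2.
  lra.
(* D does not dissipate: its growth contains |U|^2, which only the
   dissipation of e q can absorb. *)
have [dDf dDfP dDf_le] : exists2 dDf : R -> R,
    (forall t : R, 0 <= t <= T ->
       is_derive t (1 : R) (fun s => nsq (D s)) (dDf t)) &
    forall t : R, 0 <= t <= T -> dDf t <= L * (nsq (D t) + nsq (U t) + delta).
  exists (fun t => 2 * dot (D t) (N1 *m (U t + r t) + N2 *m D t)) => t tT.
    have dDt := dD _ tT; have := is_derive_dot dDt dDt.
    set v := _ + _ in dDt *.
    by have -> : dot (D t) v + dot v (D t) = 2 * dot (D t) v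
      by rewrite (dotC v); ring.
  have [rd _] := rf _ tT.
  rewrite mulmxDr !dotDr.
  move: (U t) (r t) (D t) rd => u rr dd rd.
  have y1 := dot_young dd (N1 *m u) ltr01.
  have y2 := dot_young dd (N1 *m rr) ltr01.
  have y3 := dot_young dd (N2 *m dd) ltr01.
  rewrite !invr1 !mul1r in y1 y2 y3.
  have w1 := hN1 u; have w2 := hN1 rr; have w3 := hN2 dd.
  have x2 : n1 * nsq rr <= n1 * delta by rewrite ler_pM2l.
  have u0 := nsq_ge0 u; have dd0 := nsq_ge0 dd.
  have s1 := mulr_ge0 (ltW n10) dd0; have s2 := mulr_ge0 (ltW n20) u0.
  have s3 := mulr_ge0 (ltW n20) d0.
  rewrite /L; lra.
pose S := nsq (D 0) + e * nsq (U 0) + delta + e * kappa.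
have ek0 : 0 <= e * kappa by rewrite mulr_ge0// ltW.
have eU0 : 0 <= e * nsq (U 0) by rewrite mulr_ge0 ?nsq_ge0// ltW.
have D00 := nsq_ge0 (D 0).
(* Energy estimate: lam is such that the dissipation lam c / 2 equals L. *)
have DC1 (t : R) : 0 <= t <= T -> nsq (D t) <= C1 * S.
  move=> tT; pose H s := nsq (D s) + lam * e * q s.
  have HD s : nsq (D s) <= H s.
    by rewrite lerDl mulr_ge0// mulr_ge0// ltW.
  have L'N : - L' != 0 by rewrite oppr_eq0 gt_eqF.
  have := @gronwall R H (fun s => dDf s + lam * e * dq s) (- L')
    (L' * (delta + e * kappa)) T L'N _ _ t tT.
  move=> h.
  have {}h : H t <= expR (- (- L' * t)) *
      (H 0 - L' * (delta + e * kappa) / - L') + L' * (delta + e * kappa) / - L'.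
    apply: h => s sT.
      have -> : H = (fun s => nsq (D s)) + (lam * e) *: q by [].
      have := dqP _ sT; have := dDfP _ sT => ? ?.
      exact: is_derive_eq.
    have x1 := dDf_le _ sT; have x2 := dq_le _ sT.
    have x3 : lam * (e * dq s) <= lam *
       (- (c / 2) * nsq (U s) + B * (delta + e * nsq (D s) + e * kappa)).
      by rewrite ler_pM2l.
    have x4 : lam * (- (c / 2) * nsq (U s)) = - (L * nsq (U s)).
      by rewrite /lam; field; rewrite gt_eqF.
    rewrite mulrDr x4 in x3.
    have x5 : lam * (B * (delta + e * nsq (D s) + e * kappa)) <=
              lam * B * (H s + delta + e * kappa).
      rewrite -mulrA ler_pM2l// ler_pM2l// lerD2r addrC lerD2r.
      apply: le_trans (HD s).
      by rewrite -[leRHS]mul1r ler_wpM2r ?nsq_ge0.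
    have x6 : L * nsq (D s) <= L * H s by rewrite ler_pM2l.
    have x7 : 0 <= L * (e * kappa) by rewrite mulr_ge0// ltW.
    rewrite -mulrA /L'; lra.
  apply: le_trans (HD t) _; apply: le_trans h _.
  have -> : L' * (delta + e * kappa) / - L' = - (delta + e * kappa).
    by field; rewrite gt_eqF.
  rewrite opprK mulNr opprK.
  have y0 : 0 <= delta + e * kappa by rewrite addr_ge0.
  rewrite lerBlDr; apply: ler_wpDr => //.
  have H0 : H 0 + (delta + e * kappa) <= (1 + lam * bq) * S.
    have x1 : lam * e * q 0 <= lam * e * (bq * nsq (U 0)).
      by rewrite ler_pM2l ?(mulr_gt0 lam0 epos).
    have lb : 0 < lam * bq by rewrite mulr_gt0.
    have z1 := mulr_ge0 (ltW lb) D00; have z2 := mulr_ge0 (ltW lb) y0.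
    rewrite /H /S; lra.
  apply: le_trans (_ : expR (L' * t) * ((1 + lam * bq) * S) <= _).
    by rewrite ler_pM2l ?expR_gt0.
  rewrite /C1 -[leRHS]mulrA ler_wpM2r//.
    by rewrite mulr_ge0// ?addr_ge0// mulr_ge0// ltW.
  by rewrite ler_expR ler_pM2l//; case/andP: tT.
have S0 : 0 <= S by rewrite !addr_ge0.
(* With D bounded by S, the form q decays at rate a up to an error of order
   S. *)
have qT : q T <= C2 * S.
  pose a := c / (2 * bq * e).
  have a0 : 0 < a by rewrite divr_gt0// !mulr_gt0.
  pose m := B * (1 + C1) * S / e.
  have := @gronwall R q dq a m T (lt0r_neq0 a0) dqP _ T TT.
  have step (t : R) : 0 <= t <= T -> dq t <= - a * q t + m.
    move=> tT; rewrite -(ler_pM2l epos); apply: le_trans (dq_le _ tT) _.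
    rewrite [e * (_ + m)]mulrDr /m.
    have -> : e * (B * (1 + C1) * S / e) = B * ((1 + C1) * S).
      by field; rewrite gt_eqF.
    have -> : e * (- a * q t) = - (c / 2) * (q t / bq).
      by rewrite /a; field; rewrite !gt_eqF.
    apply: lerD.
      rewrite !mulNr lerN2 ler_pM2l ?divr_gt0//.
      by rewrite ler_pdivrMr// mulrC; exact: qub.
    rewrite ler_pM2l// mulrDl mul1r.
    have x1 := DC1 _ tT.
    have x2 : e * nsq (D t) <= nsq (D t).
      by rewrite -[leRHS]mul1r ler_wpM2r ?nsq_ge0.
    rewrite {1}/S; lra.
  move=> /(_ step) /le_trans; apply.
  have -> : m / a = 2 * bq * B * (1 + C1) / c * S.
    by rewrite /m /a; field; rewrite !gt_eqF.
  have -> : C2 * S = 2 * bq ^+ 2 / (c * T) * S + 2 * bq * B * (1 + C1) / c * S.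
    exact: mulrDl.
  rewrite lerD2r.
  have ma : 0 <= 2 * bq * B * (1 + C1) / c * S.
    by rewrite !mulr_ge0 ?invr_ge0 ?addr_ge0// ltW.
  have ex : expR (- (a * T)) <= (a * T)^-1.
    rewrite expRN lef_pV2 ?posrE ?expR_gt0 ?(mulr_gt0 a0 T0)//.
    by apply: le_trans (expR_ge1Dx _); rewrite lerDr.
  apply: le_trans (_ : (a * T)^-1 * (bq * nsq (U 0)) <= _).
    apply: le_trans (_ : expR (- (a * T)) * q 0 <= _).
      by rewrite ler_pM2l ?expR_gt0// gerBl.
    by apply: ler_pM => //; rewrite expR_ge0.
  have -> : (a * T)^-1 * (bq * nsq (U 0)) =
      2 * bq ^+ 2 / (c * T) * (e * nsq (U 0)).
    by rewrite /a; field; rewrite !gt_eqF.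
  rewrite ler_wpM2l//.
    by rewrite !mulr_ge0 ?invr_ge0 ?mulr_ge0 ?exprn_ge0// ltW.
  by rewrite /S; lra.
rewrite mulrDl; apply: lerD; last exact: DC1.
rewrite mulrAC ler_pdivlMr// mulrC; exact: le_trans (q0 T) qT.
Qed.

End energy.

(** * The singular limit along one path *)

Section pathwise.
Context {R : realType}.

Lemma dot_col_mx m n (u1 v1 : 'cV[R]_m) (u2 v2 : 'cV[R]_n) :
  dot (col_mx u1 u2) (col_mx v1 v2) = dot u1 v1 + dot u2 v2.
Proof. by rewrite !dotE tr_col_mx mul_row_col mxE. Qed.

Lemma dot_delta m (u : 'cV[R]_m) i : dot u (delta_mx i ord0) = u i ord0.
Proof.
rewrite /dot (bigD1 i)//= mxE !eqxx mulr1 big1 ?addr0// => j ji.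
by rewrite mxE (negbTE ji) mulr0.
Qed.

(** Along a line the squared distance is a quadratic polynomial, so the
    difference quotient is explicit. *)
Lemma grad_dist_constraint k l (b : 'cV[R]_k) (x : 'cV[R]_(k + l)) :
  grad (fun y => enorm (xi b y) ^+ 2) x = 2 *: col_mx (xi b x) 0.
Proof.
apply/colP => i; rewrite mxE [RHS]mxE; set v := delta_mx _ _.
pose u := xi b x; pose v1 := usubmx v.
have uE h : enorm (xi b (h *: v + x)) ^+ 2 =
    nsq u + 2 * h * dot u v1 + h ^+ 2 * nsq v1.
  have -> : xi b (h *: v + x) = u + h *: v1.
    by rewrite /xi linearD/= linearZ/= -addrA addrC.
  clearbody u v1; rewrite enorm_sqr /nsq.
  by rewrite !(dotDl, dotDr) !(dotZl, dotZr) (dotC v1 u); ring.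
have -> : 2 * (col_mx (xi b x) 0 : 'cV[R]_(k + l)) i ord0 = 2 * dot u v1.
  congr (_ * _); rewrite -dot_delta -/v -(vsubmxK v) dot_col_mx -/u -/v1.
  by rewrite [X in _ + X]big1 ?addr0// => j _; rewrite mxE mul0r.
apply/cvg_lim; first exact: Rhausdorff.
apply: (@cvg_trans _ ((fun h : R => 2 * dot u v1 + h * nsq v1) @ 0^')).
  apply: near_eq_cvg; near=> h.
  have h0 : h != 0 by near: h; exact: nbhs_dnbhs_neq.
  rewrite /= uE enorm_sqr -/u -[RHS]/(h^-1 * _); field; exact: h0.
have : 2 * dot u v1 + h * nsq v1 @[h --> 0^'] --> 2 * dot u v1 + 0 * nsq v1.
  apply: cvgD; first exact: cvg_cst.
  apply: cvgM; last exact: cvg_cst.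
  by apply: cvg_within_filter; exact: cvg_id.
by rewrite mul0r addr0.
Unshelve. all: by end_near. Qed.

Lemma penalized_driftE k l (b : 'cV[R]_k) (M K : 'M[R]_(k + l)) (e : R) x :
  penalized_drift b M K e x = M *m x - e^-1 *: (K *m col_mx (xi b x) 0).
Proof.
rewrite /penalized_drift grad_dist_constraint -scalemxAr scalerA invfM.
by rewrite mulrAC mulVf ?pnatr_eq0// mul1r.
Qed.

(** Continuity is recorded by coordinates, which is the form in which primitives
    are taken. *)
Definition cpath m (U : R -> 'cV[R]_m) :=
  forall i, {within `[0, +oo[, continuous (fun s => U s i ord0)}.

Lemma cpath_continuous m (U : R -> 'cV[R]_m) :
  {within `[0, +oo[, continuous U} -> cpath U.
Proof.
move=> cU i; apply: (@within_continuous_comp _ _ _ _ U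
  (fun M : 'cV[R]_m => M i ord0)) => // x _.
exact: coord_continuous.
Qed.

Lemma cpath_mulmx m n (N : 'M[R]_(n, m)) (U : R -> 'cV[R]_m) :
  cpath U -> cpath (fun s => N *m U s).
Proof.
move=> cU i.
have -> : (fun s => (N *m U s) i ord0) = (fun s => \sum_j N i j * U s j ord0).
  by apply/funext => s; rewrite mxE.
move=> s; apply: cvg_big => [|j _]; first exact: add_continuous.
by apply: cvgM; [exact: cvg_cst|exact: cU].
Qed.

Lemma cpathD m (U V : R -> 'cV[R]_m) :
  cpath U -> cpath V -> cpath (fun s => U s + V s).
Proof.
move=> cU cV i.
have -> : (fun s => (U s + V s) i ord0) =
    (fun s => U s i ord0 + V s i ord0) by apply/funext => s; rewrite mxE.
by move=> s; apply: cvgD; [exact: cU|exact: cV].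
Qed.

Lemma cpath_cst m (a : 'cV[R]_m) : cpath (fun _ => a).
Proof. by move=> i s; exact: cvg_cst. Qed.

Lemma bounded_cpath m (U : R -> 'cV[R]_m) (T : R) : cpath U ->
  exists M, forall t : R, 0 <= t <= T -> nsq (U t) <= M.
Proof.
move=> cU; have /choice[M MP] := fun i => bounded_halfline T (cU i).
exists (\sum_i M i ^+ 2) => t tT; apply: ler_sum => i _.
rewrite -expr2 -real_normK ?num_real//.
by rewrite lerXn2r// ?nnegrE ?(le_trans _ (MP i t tT))// MP.
Qed.

(** What [ito_eq] says about a single trajectory. *)
Definition ito_path n (w : R -> 'cV[R]_n) m (beta : R -> 'cV[R]_m)
    (S : 'M[R]_(m, n)) (x : R -> 'cV[R]_m) : Prop :=
  forall t : R, 0 <= t ->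
    x t = x 0
        + \col_i (\int[lebesgue_measure]_(s in `[0%R, t]) beta s i ord0)%R
        + S *m (w t - w 0).

(** Subtracting the noise leaves a differentiable path. *)
Lemma ito_path_primitive n (w : R -> 'cV[R]_n) m (beta : R -> 'cV[R]_m)
    (S : 'M[R]_(m, n)) (x : R -> 'cV[R]_m) :
  cpath beta -> ito_path w beta S x ->
  exists J : R -> 'cV[R]_m,
    [/\ forall t : R, 0 <= t -> vderive J t (beta t),
        forall t : R, 0 <= t -> x t = x 0 + J t + S *m (w t - w 0)
      & J 0 = 0].
Proof.
move=> cb ix; have [J [dJ JE]] := vprimitive_halfline cb.
have xE (t : R) : 0 <= t -> x t = x 0 + J t + S *m (w t - w 0).
  by move=> t0; rewrite ix// JE.
exists J; split => //; have := xE 0 (lexx 0).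
rewrite subrr mulmx0 addr0 => /eqP.
by rewrite addrC -subr_eq subrr eq_sym => /eqP.
Qed.

Lemma hurwitz_unitmx k (A : 'M[R]_k) : hurwitz (- A) -> A \in unitmx.
Proof.
move=> hA; have [//|] := boolP (A \in unitmx).
rewrite unitmxE unitfE negbK => /det0P[v v0 vA].
have /hA : eigenvalue (map_mx (real_complex R) (- A)) 0.
  apply/eigenvalueP; exists (map_mx (real_complex R) v).
    by rewrite scale0r -map_mxM mulmxN vA oppr0 map_mx0.
  by rewrite map_mx_eq0.
by rewrite /= ltxx.
Qed.

Lemma nsq_usubmx m n (u : 'cV[R]_(m + n)) : nsq (usubmx u) <= nsq u.
Proof.
by rewrite -{2}(vsubmxK u) /nsq dot_col_mx lerDl nsq_ge0.
Qed.

(** rho depends on the path w and on the limit solution y, but neither on e nor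
    on the perturbed solution x: only the size of e and the distance of the
    initial data matter. *)
Theorem pathwise_limit k l n (b : 'cV[R]_k) (M K : 'M[R]_(k + l))
    (S : 'M[R]_(k + l, n)) (w : R -> 'cV[R]_n) (x0 : 'cV[R]_(k + l))
    (y : R -> 'cV[R]_(k + l)) (T tol : R) :
  let alpha : 'M[R]_(l, k) := - dlsubmx K *m invmx (ulsubmx K) in
  let P : 'M[R]_(k + l) := block_mx 0 0 alpha 1%:M in
  let b0 : 'cV[R]_(k + l) := col_mx b 0 in
  (0 < k)%N -> hurwitz (- ulsubmx K) -> 0 < T -> 0 < tol ->
  cpath w -> cpath y ->
  y 0 = P *m (x0 - b0) + b0 ->
  ito_path w (fun t => P *m M *m y t) (P *m S) y ->
  exists2 rho, 0 < rho & forall (e : R) (x : R -> 'cV[R]_(k + l)),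
    0 < e <= rho -> cpath x ->
    ito_path w (fun t => penalized_drift b M K e (x t)) S x ->
    nsq (x 0 - x0) <= rho -> nsq (x T - y T) <= tol.
Proof.
move=> alpha P b0 k0 hK T0 tol0 cw cy y0 iy.
pose A := ulsubmx K.
have Au : A \in unitmx by exact: hurwitz_unitmx.
pose N : 'M[R]_(l, k + l) := row_mx alpha 1%:M.
have PE : P = col_mx 0 N by rewrite /P /N block_mxEh -block_mxEh block_mxEv row_mx0.
have NP m (Z : 'M[R]_(k + l, m)) : N *m (P *m Z) = N *m Z.
  by rewrite PE mul_col_mx mul0mx mul_row_col mulmx0 add0r mul1mx.
(* alpha cancels the stiff term. *)
have NK (u : 'cV[R]_k) : N *m (K *m col_mx u 0) = 0.
  rewrite -{1}(submxK K) mul_block_col !mulmx0 !addr0 mul_row_col mul1mx.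
  have aA : alpha *m A = - dlsubmx K by rewrite /alpha -mulmxA mulVmx// mulmx1.
  by rewrite mulmxA aA mulNmx addNr.
have uP m (Z : 'M[R]_(k + l, m)) : usubmx (P *m Z) = 0.
  by rewrite PE mul_col_mx mul0mx col_mxKu.
have cby : cpath (fun t => P *m M *m y t) by exact: cpath_mulmx.
have [Jy [dJy Jyt Jy0]] := ito_path_primitive cby iy.
have uy (t : R) : 0 <= t -> usubmx (y t) = b.
  move=> t0; rewrite iy//; set I := \col__ _.
  have -> : usubmx (y 0 + I + P *m S *m (w t - w 0)) =
      usubmx (y 0) + usubmx I + usubmx (P *m S *m (w t - w 0)).
    by rewrite !linearD.
  have -> : usubmx I = 0.
    apply/colP => i; rewrite !mxE.
    rewrite (@eq_Rintegral _ _ _ _ _ (cst 0)) => [|s _].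
      by rewrite Rintegral_cst// mul0r.
    by rewrite -mulmxA PE mul_col_mx mul0mx col_mxEu mxE.
  rewrite -(mulmxA P) uP !addr0 y0.
  by rewrite [LHS]linearD/= uP add0r col_mxKu.
(* The two variables U = x^1 - b and D = N (x - y) determine x - y. *)
pose F1 : 'M[R]_(k + l, k) := col_mx 1%:M (- alpha).
pose F2 : 'M[R]_(k + l, l) := col_mx 0 1%:M.
have recon (z v : 'cV[R]_(k + l)) : usubmx v = b ->
    z - v = F1 *m xi b z + F2 *m (N *m (z - v)).
  move=> vb; have uzv : usubmx (z - v) = xi b z by rewrite linearB/= vb.
  rewrite /F1 /F2 !mul_col_mx !mul1mx mul0mx add_col_mx addr0 -uzv.
  rewrite -{1}(vsubmxK (z - v)); congr col_mx.
  rewrite -{3}(vsubmxK (z - v)) mul_row_col mul1mx.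
  by rewrite mulNmx addrA addNr add0r.
pose B t := usubmx (S *m (w t - w 0)).
have cB : cpath B.
  move=> i; have : cpath (fun t => S *m (w t - w 0)).
    by apply: cpath_mulmx; apply: cpathD => //; exact: cpath_cst.
  move=> /(_ (lshift l i)); rewrite /B.
  have -> // : (fun s => usubmx (S *m (w s - w 0)) i ord0) =
    (fun s => (S *m (w s - w 0)) (lshift l i) ord0).
  by apply/funext => s; rewrite mxE.
have [Q [c c0 [Qsym Qc QA]]] := lyapunov k0 hK.
pose G1 := usubmx M *m F1; pose G2 := usubmx M *m F2.
pose N1 := N *m M *m F1; pose N2 := N *m M *m F2.
have [CE CE0 [e0 e00 en]] := energy_estimate G1 G2 N1 N2 Qsym c0 Qc QA T0.
have [f1 f10 hf1] := nsq_mulmx F1; have [f2 f20 hf2] := nsq_mulmx F2.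
have [cN cN0 hcN] := nsq_mulmx N.
pose C4 := 4 * (f1 + f2); have C40 : 0 < C4 by rewrite mulr_gt0// addr_gt0.
pose delta := tol / (2 * C4 * (CE + 1)).
have CE1 : 0 < CE + 1 by rewrite addr_gt0.
have C42 : 0 < 2 * C4 by rewrite mulr_gt0.
have delta0 : 0 < delta by rewrite divr_gt0// (mulr_gt0 C42).
(* delta does not depend on e; kg, the price of smoothing the noise, is fixed
   before e is chosen. *)
have [g [dg [kg gP]]] := vsmooth_approximation cB (ltW T0) delta0.
have [My MyP] : exists Z, forall t : R, 0 <= t <= T ->
    nsq (usubmx (M *m y t)) <= Z.
  have [Z ZP] := bounded_cpath T (@cpath_mulmx _ _ M _ cy).
  by exists Z => t tT; apply: le_trans (nsq_usubmx _) _; exact: ZP.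
have T00 : 0 <= (0 : R) <= T by rewrite lexx ltW.
have My0 : 0 <= My by apply: le_trans (MyP _ T00); exact: nsq_ge0.
have kg0 : 0 <= kg.
  by have [_ _ h] := gP _ T00; apply: le_trans h; exact: nsq_ge0.
pose kappa := 2 * My + 2 * kg.
have kappa0 : 0 <= kappa by rewrite addr_ge0 ?mulr_ge0.
pose Kc := 4 + 4 * nsq (usubmx x0 - b) + 2 * nsq (g 0).
have Kc0 : 0 < Kc.
  have := nsq_ge0 (usubmx x0 - b); have := nsq_ge0 (g 0); rewrite /Kc; lra.
pose Z := cN + Kc + kappa.
have Z0 : 0 < Z by rewrite ltr_wpDr// addr_gt0.
pose rho := Num.min (Num.min 1 e0) (tol / (2 * C4 * CE * Z)).
have CZ : 0 < 2 * C4 * CE * Z by rewrite (mulr_gt0 (mulr_gt0 C42 CE0)).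
have rho0 : 0 < rho by rewrite !lt_min ltr01 e00 divr_gt0.
exists rho => // e x /andP[epos erho] cx ix xx0.
have rho1 : rho <= 1 by rewrite !ge_min lexx.
have rhoe0 : rho <= e0 by rewrite !ge_min lexx orbT.
have rhoZ : 2 * C4 * CE * Z * rho <= tol.
  by rewrite mulrC -ler_pdivlMr// ge_min lexx orbT.
have cbx : cpath (fun t => penalized_drift b M K e (x t)).
  pose E : 'M[R]_(k + l) := block_mx 1%:M 0 0 0.
  have drE t : penalized_drift b M K e (x t) =
      (M - e^-1 *: (K *m E)) *m x t + e^-1 *: (K *m b0).
    have cE : col_mx (xi b (x t)) 0 = E *m x t - b0.
      rewrite -{2}(vsubmxK (x t)) mul_block_col !mul0mx !addr0 mul1mx.
      by rewrite opp_col_mx add_col_mx subr0.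
    rewrite penalized_driftE cE mulmxBr scalerBr opprB mulmxBl -scalemxAl.
    by rewrite -mulmxA addrA addrAC.
  rewrite (_ : (fun t => _) = fun t =>
    (M - e^-1 *: (K *m E)) *m x t + e^-1 *: (K *m b0)); last exact/funext.
  by apply: cpathD; [exact: cpath_mulmx|exact: cpath_cst].
have [Jx [dJx Jxt Jx0]] := ito_path_primitive cbx ix.
pose U0 := xi b (x 0).
pose U t := U0 + usubmx (Jx t) + g t.
pose r t := B t - g t.
pose D t := N *m (x 0 - y 0 + (Jx t - Jy t)).
have UrE (t : R) : 0 <= t -> U t + r t = xi b (x t).
  move=> t0; rewrite /U /r -addrA [g t + _]addrC subrK (Jxt _ t0) /U0 /xi.
  have usubD (p q : 'cV[R]_(k + l)) : usubmx (p + q) = usubmx p + usubmx q.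
    exact: linearD.
  rewrite !usubD -/(B t).
  by rewrite [usubmx (x 0) - b + _]addrAC [RHS]addrAC.
(* D is defined without the noise, which cancels since N P = N. *)
have DE (t : R) : 0 <= t -> D t = N *m (x t - y t).
  move=> t0; rewrite (Jxt _ t0) (Jyt _ t0) -(mulmxA P) /D.
  set v := S *m _; have -> : x 0 + Jx t + v - (y 0 + Jy t + P *m v) =
      (x 0 - y 0 + (Jx t - Jy t)) + (v - P *m v).
    by rewrite opprD addrACA opprD [x 0 + _ + _]addrACA.
  by rewrite [RHS]mulmxDr [N *m (v - _)]mulmxBr NP subrr addr0.
have dU (t : R) : 0 <= t <= T -> vderive U t
    (usubmx (M *m y t) + dg t + G1 *m (U t + r t) + G2 *m D t
      - e^-1 *: (A *m (U t + r t))).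
  move=> tT; have /andP[t0 _] := tT; have [dgt _ _] := gP _ tT.
  have -> : usubmx (M *m y t) + dg t + G1 *m (U t + r t) + G2 *m D t
      - e^-1 *: (A *m (U t + r t)) =
      0 + usubmx (penalized_drift b M K e (x t)) + dg t.
    rewrite (UrE _ t0) (DE _ t0) penalized_driftE add0r.
    have -> : usubmx (M *m x t - e^-1 *: (K *m col_mx (xi b (x t)) 0)) =
        usubmx (M *m x t) - e^-1 *: usubmx (K *m col_mx (xi b (x t)) 0).
      by rewrite linearB linearZ.
    have -> : usubmx (K *m col_mx (xi b (x t)) 0) = A *m xi b (x t).
      by rewrite -{1}(submxK K) mul_block_col mulmx0 addr0 col_mxKu.
    have -> : M *m x t = M *m y t +
        M *m (F1 *m xi b (x t) + F2 *m (N *m (x t - y t))).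
      by rewrite -(recon _ _ (uy _ t0)) -mulmxDr addrC subrK.
    rewrite [usubmx (M *m y t + _)]linearD/=.
    have -> : usubmx (M *m (F1 *m xi b (x t) + F2 *m (N *m (x t - y t)))) =
        G1 *m xi b (x t) + G2 *m (N *m (x t - y t)).
      by rewrite mulmxDr [LHS]linearD/= !mulmxA -!mul_usub_mx.
    by rewrite [RHS]addrAC; congr (_ - _); rewrite -addrA addrAC.
  apply: vderiveD => //; apply: vderiveD; first exact: vderive_cst.
  exact: vderive_usubmx (dJx _ t0).
have dD (t : R) : 0 <= t <= T -> vderive D t (N1 *m (U t + r t) + N2 *m D t).
  move=> tT; have /andP[t0 _] := tT.
  have -> : N1 *m (U t + r t) + N2 *m D t =
      N *m (0 + (penalized_drift b M K e (x t) - P *m M *m y t)).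
    rewrite (UrE _ t0) (DE _ t0) -!(mulmxA (N *m M)) -mulmxDr.
    rewrite -(recon _ _ (uy _ t0)) add0r penalized_driftE.
    rewrite [N *m (_ - _ - _)]mulmxBr [N *m (M *m x t - _)]mulmxBr.
    by rewrite -scalemxAr NK scaler0 subr0 -!mulmxA NP -!mulmxBr.
  apply: vderive_mulmx; apply: vderiveD; first exact: vderive_cst.
  exact: vderiveB (dJx _ t0) (dJy _ t0).
have rf (t : R) : 0 <= t <= T -> nsq (r t) <= delta /\
    nsq (usubmx (M *m y t) + dg t) <= kappa.
  move=> tT; have [_ rd dk] := gP _ tT; split => //.
  apply: le_trans (nsqD_le _ _) _; apply: lerD; rewrite ler_pM2l//.
  exact: MyP.
have ee0 : 0 < e <= e0 by rewrite epos (le_trans erho).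
have := en e delta kappa U r (fun t => usubmx (M *m y t) + dg t) D ee0 dU dD rf.
have D0 : nsq (D 0) <= cN * rho.
  have -> : D 0 = N *m (x 0 - x0).
    rewrite /D Jx0 Jy0 subrr addr0 y0 [LHS]mulmxBr [RHS]mulmxBr; congr (_ - _).
    by rewrite mulmxDr NP -mulmxDr subrK.
  by apply: le_trans (hcN _) _; rewrite ler_pM2l.
have U00 : nsq (U 0) <= Kc.
  have -> : U 0 = usubmx (x 0 - x0) + (usubmx x0 - b) + g 0.
    rewrite /U Jx0 linear0 addr0 /U0 /xi linearB/=.
    by congr (_ + _); rewrite addrA subrK.
  have := nsqD_le (usubmx (x 0 - x0) + (usubmx x0 - b)) (g 0).
  have := nsqD_le (usubmx (x 0 - x0)) (usubmx x0 - b).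
  have := nsq_usubmx (x 0 - x0); rewrite /Kc; lra.
move=> main.
have T0' := ltW T0.
have uyT := uy _ T0'.
rewrite (recon _ _ uyT) -(UrE _ T0') -(DE _ T0').
have TT : 0 <= T <= T by rewrite T0' lexx.
have [rT _] := rf _ TT.
have := nsqD_le (F1 *m (U T + r T)) (F2 *m D T).
have := hf1 (U T + r T); have := hf2 (D T); have := nsqD_le (U T) (r T).
have uT := nsq_ge0 (U T); have dT := nsq_ge0 (D T).
move=> z1 z2 z3 z4.
have z5 : f1 * nsq (U T + r T) <= f1 * (2 * nsq (U T) + 2 * nsq (r T)).
  by rewrite ler_pM2l.
have z6 : f1 * nsq (r T) <= f1 * delta by rewrite ler_pM2l.
have z7 := mulr_ge0 (ltW f20) uT; have z8 := mulr_ge0 (ltW f10) dT.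
have z9 := mulr_ge0 (ltW f20) (ltW delta0).
have z10 := mulr_ge0 (ltW f20) dT.
have bound : nsq (F1 *m (U T + r T) + F2 *m D T) <=
    C4 * (nsq (U T) + nsq (D T) + delta) by rewrite /C4; lra.
apply: le_trans bound _.
have S_le : nsq (D 0) + e * nsq (U 0) + delta + e * kappa <= Z * rho + delta.
  have w1 : e * nsq (U 0) <= Kc * rho.
    by rewrite mulrC; apply: ler_pM => //; [exact: nsq_ge0|exact: ltW].
  have w2 : e * kappa <= kappa * rho by rewrite mulrC ler_wpM2l.
  rewrite /Z; lra.
have main' : nsq (U T) + nsq (D T) <= CE * (Z * rho + delta).
  by apply: le_trans main _; rewrite ler_pM2l.
have dE : 2 * C4 * (CE + 1) * delta = tol.
  by rewrite /delta; field; rewrite !gt_eqF.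
have : C4 * (nsq (U T) + nsq (D T) + delta) <=
    C4 * (CE * (Z * rho + delta) + delta).
  by rewrite ler_pM2l// lerD2r.
move=> /le_trans; apply; lra.
Qed.

End pathwise.

(** * From paths to convergence in probability *)

Section convergence_in_probability.
Context {R : realType} {d : measure_display} {Om : measurableType d}.
Context (Pr : probability Om R).

Lemma measurable_enorm_gt m (U V : Om -> 'cV[R]_m) (delta : R) :
  measurable_for measurable U -> measurable_for measurable V -> 0 <= delta ->
  measurable [set w | delta < enorm (U w - V w)].
Proof.
move=> mU mV d0.
have mf : measurable_fun setT (fun w => nsq (U w - V w)).
  apply: measurable_sum => i.
  have mW : measurable_fun setT (fun w => (U w - V w) i ord0).
    have -> : (fun w => (U w - V w) i ord0) =
        (fun w => U w i ord0) \- (fun w => V w i ord0).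
      by apply/funext => w; rewrite !mxE.
    apply: measurable_funB => _ A mA; rewrite setTI; [exact: mU|exact: mV].
  exact: measurable_funM.
have -> : [set w | delta < enorm (U w - V w)] =
    setT `&` (fun w => nsq (U w - V w)) @^-1` `]delta ^+ 2, +oo[.
  rewrite setTI; apply/seteqP; split => w /=;
    by rewrite in_itv/= andbT -enorm_sqr ltr_pXn2r// nnegrE enorm_ge0.
by apply: mf => //; exact: measurable_itv.
Qed.

Definition path_cvg m (u : nat -> 'cV[R]_m) (v : 'cV[R]_m) :=
  forall rho, 0 < rho -> exists N, forall n, (N <= n)%N -> nsq (u n - v) <= rho.

Lemma cvg_probability_squeeze (A : R -> set Om) :
  (forall eta : R, 0 < eta -> exists2 rho : R, 0 < rho &
     forall e, 0 < e < rho -> (Pr (A e) <= eta%:E)%E) ->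
  Pr (A e) @[e --> 0^'+] --> 0%E.
Proof.
move=> hA.
apply/fine_cvgP; split.
  have [rho rho0 le1] := hA 1 ltr01; near=> e.
  have e01 : 0 < e < rho.
    by apply/andP; split; near: e; [exact: nbhs_right_gt|exact: nbhs_right_lt].
  by rewrite ge0_fin_numE// (le_lt_trans (le1 _ e01))// ltry.
apply/cvgr0Pnorm_le => eta eta0.
have [rho rho0 leta] := hA _ eta0; near=> e.
have e0 : 0 < e < rho.
  by apply/andP; split; near: e; [exact: nbhs_right_gt|exact: nbhs_right_lt].
have lee := leta _ e0; rewrite /= ger0_norm ?fine_ge0//.
rewrite -lee_fin fineK// ge0_fin_numE//.
exact: le_lt_trans lee (ltry _).
Unshelve. all: by end_near. Qed.

(** Almost sure convergence along every sequence on which the data converge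
    suffices.  If the conclusion failed, one could pick e_n -> 0 with the
    deviation of U of probability more than eta, and that of U0 by 2^-(n+1) of
    probability at most 2^-(n+1).  By Borel-Cantelli the data converge almost
    surely along e_n, so the limsup of the deviations of U is null; but its
    probability is the limit of those of the tail unions, which exceed eta. *)
Theorem cvg_in_probability_of_paths m1 m2
    (U0 : R -> Om -> 'cV[R]_m1) (V0 : Om -> 'cV[R]_m1)
    (U : R -> Om -> 'cV[R]_m2) (V : Om -> 'cV[R]_m2) :
  (forall e, 0 < e -> measurable_for measurable (U0 e)) ->
  measurable_for measurable V0 ->
  (forall e, 0 < e -> measurable_for measurable (U e)) ->
  measurable_for measurable V ->
  (forall e_ : nat -> R, (forall n, 0 < e_ n) -> e_ @ \oo --> 0 ->
    {ae Pr, forall w, path_cvg (fun n => U0 (e_ n) w) (V0 w) ->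
                      path_cvg (fun n => U (e_ n) w) (V w)}) ->
  cvg_in_probability Pr U0 0^'+ V0 -> cvg_in_probability Pr U 0^'+ V.
Proof.
move=> mU0 mV0 mU mV seqUV cU0 delta delta0; apply: cvg_probability_squeeze.
move=> eta eta0; apply: contrapT => nrho.
pose thr n : R := 1 / (2 ^ n.+1)%:R.
have thr0 n : 0 < thr n by rewrite divr_gt0// ltr0n expn_gt0.
have step n : exists e, [/\ 0 < e, e < n.+1%:R^-1,
    (Pr [set w | (thr n < enorm (U0 e w - V0 w))%R] <= (thr n)%:E)%E &
    (eta%:E < Pr [set w | (delta < enorm (U e w - V w))%R])%E].
  have : \forall e \near (0 : R)^'+,
      (Pr [set w | (thr n < enorm (U0 e w - V0 w))%R] < (thr n)%:E)%E.
    have h := @nbhs_open_ereal_lt R 0 (fun=> thr n) (thr0 n).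
    exact: (cU0 _ (thr0 n) _ h).
  move=> /nbhs_ballP[r /= r0 rP].
  apply: contrapT => ne; apply: nrho; exists (Num.min r n.+1%:R^-1).
    by rewrite lt_min r0 invr_gt0 ltr0n.
  move=> e /andP[e0]; rewrite lt_min => /andP[er en].
  rewrite leNgt; apply/negP => lt; apply: ne; exists e; split => //.
  apply/ltW/rP => //=.
  by rewrite /ball/= sub0r normrN gtr0_norm.
have [e_ eP] := choice step.
pose F n := [set w | thr n < enorm (U0 (e_ n) w - V0 w)].
pose A n := [set w | delta < enorm (U (e_ n) w - V w)].
have e_0 n : 0 < e_ n by have [] := eP n.
have mF n : measurable (F n).
  by apply: measurable_enorm_gt => //; [exact: mU0|exact: ltW].
have mA n : measurable (A n).
  by apply: measurable_enorm_gt => //; [exact: mU|exact: ltW].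
have F0 : Pr (lim_sup_set F) = 0%E.
  apply: lim_sup_set_cvg0 => //.
  apply: (@le_lt_trans _ _ 1%:E); last exact: ltry.
  apply: le_trans (epsilon_trick0 xpredT ler01).
  by apply: lee_nneseries => // n _; have [] := eP n.
have e_cvg : e_ @ \oo --> 0.
  apply/cvgr0Pnorm_lt => x x0; have := near_infty_natSinv_lt (PosNum x0).
  apply: filterS => n /= h; rewrite gtr0_norm//; apply: lt_trans h.
  by have [] := eP n.
have A0 : Pr (lim_sup_set A) = 0%E.
  apply: measure_negligible.
    apply: bigcap_measurable => // n _.
    by apply: bigcup_measurable => j _; exact: mA.
  apply: (@negligibleS _ _ _ _ (lim_sup_set F `|`
     ~` [set w | path_cvg (fun n => U0 (e_ n) w) (V0 w) ->
                 path_cvg (fun n => U (e_ n) w) (V w)])); last first.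
    apply: negligibleU; last exact: seqUV.
    apply/negligibleP => //.
    apply: bigcap_measurable => // n _.
    by apply: bigcup_measurable => j _; exact: mF.
  move=> w Aw; have [Fw|nFw] := pselect (lim_sup_set F w); [by left|right => UV].
  have [n nF] : exists n, forall j, (n <= j)%N -> ~ F j w.
    apply: contrapT => h; apply: nFw => n _.
    apply: contrapT => h2; apply: h; exists n => j nj Fj; apply: h2.
    by exists j.
  have {UV}/(_ _ (exprn_gt0 2 delta0)) [N NP] : path_cvg (fun n => U (e_ n) w) (V w).
    apply: UV => rho rho0.
    have [N _ NP] := near_infty_natSinv_lt (PosNum rho0).
    exists (maxn n N) => j; rewrite geq_max => /andP[nj Nj].
    have /negP := nF _ nj; rewrite /F/= -leNgt => le.
    apply: le_trans (ltW (NP _ Nj)).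
    have thr1 : thr j <= j.+1%:R^-1.
      rewrite /thr div1r lef_pV2 ?posrE ?ltr0n ?expn_gt0// ler_nat.
      by rewrite (leq_trans _ (ltnW (ltn_expl _ _)))// leqnSn.
    apply: le_trans thr1; rewrite -enorm_sqr.
    have thrle : thr j <= 1.
      by rewrite /thr div1r invf_le1 ?ltr0n ?expn_gt0// ler1n expn_gt0.
    rewrite expr2 -[leRHS]mul1r; apply: ler_pM => //; try exact: enorm_ge0.
    exact: le_trans le thrle.
  have [j /= Nj Aj] := Aw N I.
  have := NP _ Nj; rewrite -enorm_sqr leNgt ltr_pXn2r ?nnegrE ?enorm_ge0 ?(ltW delta0)//.
  by rewrite Aj.
have : (eta%:E <= 0)%E.
  rewrite -A0.
  have cA : Pr (\bigcup_(k >= n) A k) @[n --> \oo] --> Pr (lim_sup_set A).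
    apply: lim_sup_set_cvg => //.
    apply: le_lt_trans (probability_le1 _ _) (ltry _).
    exact: bigcup_measurable.
  rewrite -(cvg_lim _ cA)//; apply: lime_ge; first by apply/cvg_ex; eexists; exact: cA.
  apply: nearW => n; have [_ _ _ /ltW h] := eP n; apply: le_trans h _.
  apply: le_measure; rewrite ?inE; [exact: mA|exact: bigcup_measurable|].
  by move=> w Aw; exists n => /=.
by rewrite lee_fin leNgt eta0.
Qed.

End convergence_in_probability.

(** * Block form of the limit equation *)

Section block_form.
Context {R : realType}.

Lemma ito_path_col_mx k l n (w : R -> 'cV[R]_n) (b1 : R -> 'cV[R]_k)
    (b2 : R -> 'cV[R]_l) (S1 : 'M[R]_(k, n)) (S2 : 'M[R]_(l, n))
    (x : R -> 'cV[R]_(k + l)) :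
  ito_path w (fun t => col_mx (b1 t) (b2 t)) (col_mx S1 S2) x <->
  ito_path w b1 S1 (fun t => usubmx (x t)) /\
  ito_path w b2 S2 (fun t => dsubmx (x t)).
Proof.
have intE t : \col_i (\int[lebesgue_measure]_(s in `[0%R, t])
      col_mx (b1 s) (b2 s) i ord0)%R =
    col_mx (\col_i (\int[lebesgue_measure]_(s in `[0%R, t]) b1 s i ord0)%R)
      (\col_i (\int[lebesgue_measure]_(s in `[0%R, t]) b2 s i ord0)%R).
  apply/colP => i; rewrite mxE; case: (split_ordP i) => j ->.
    rewrite col_mxEu mxE; congr Rintegral.
    by apply/funext => s; rewrite col_mxEu.
  rewrite col_mxEd mxE; congr Rintegral.
  by apply/funext => s; rewrite col_mxEd.
split=> [ix|[i1 i2] t t0].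
  by split=> t t0; rewrite ix// intE mul_col_mx !linearD/=
    ?(col_mxKu, col_mxKd).
rewrite intE mul_col_mx -[LHS]vsubmxK i1// i2// -{3}(vsubmxK (x 0)).
by rewrite !add_col_mx.
Qed.

Lemma drift_block_form k l (alpha : 'M[R]_(l, k)) (M : 'M[R]_(k + l))
    (z : 'cV[R]_(k + l)) :
  (block_mx 0 0 alpha 1%:M : 'M[R]_(k + l)) *m M *m z =
  col_mx 0 ((alpha *m ulsubmx M + dlsubmx M) *m usubmx z
          + (alpha *m ursubmx M + drsubmx M) *m dsubmx z).
Proof.
rewrite -{1}(submxK M) mulmx_block !mul0mx !addr0 !mul1mx.
by rewrite -{1}(vsubmxK z) mul_block_col !mul0mx addr0.
Qed.

Lemma noise_block_form k l n1 n2 (alpha : 'M[R]_(l, k))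
    (C : 'M[R]_(k + l, n1 + n2)) :
  (block_mx 0 0 alpha 1%:M : 'M[R]_(k + l)) *m C =
  col_mx 0 (row_mx (alpha *m ulsubmx C + dlsubmx C)
                   (alpha *m ursubmx C + drsubmx C)).
Proof.
rewrite -{1}(submxK C) mulmx_block !mul0mx !addr0 !mul1mx.
by rewrite block_mxEv row_mx0.
Qed.

End block_form.

(** * The theorem *)

Unset Implicit Arguments.
Set Strict Implicit.
Set Printing Implicit Defensive.

Theorem theorem3p1 (R : realType) (k l n1 n2 : nat) (hk : (0 < k)%N)
    (hl : (0 < l)%N) (b : 'cV[R]_k) (M K : 'M[R]_(k + l))
    (C : 'M[R]_(k + l, n1 + n2))
    (d : measure_display) (Om : measurableType d) (Pr : probability Om R)
    (F : R -> set (set Om)) (W : R -> Om -> 'cV[R]_(n1 + n2))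
    (Xeps0 : R -> Om -> 'cV[R]_(k + l)) (X0 : Om -> 'cV[R]_(k + l))
    (X : R -> R -> Om -> 'cV[R]_(k + l)) (Y : R -> Om -> 'cV[R]_(k + l)) :
  let alpha : 'M[R]_(l, k) := - dlsubmx K *m invmx (ulsubmx K) in
  let P : 'M[R]_(k + l) := block_mx 0 0 alpha 1%:M in
  let b0 : 'cV[R]_(k + l) := col_mx b 0 in
  let limit_solution := sde_solution Pr F W (fun y => P *m M *m y)
    (Num.sqrt 2 *: (P *m C)) (fun w => P *m (X0 w - b0) + b0) in
  filtration F ->
  brownian_motion Pr F W ->
  (forall eps, 0 < eps -> measurable_for measurable (Xeps0 eps)) ->
  measurable_for measurable X0 ->
  (forall eps, 0 < eps ->
    sde_solution Pr F W (penalized_drift b M K eps) (Num.sqrt 2 *: C)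
      (Xeps0 eps) (X eps)) ->
  hurwitz (- ulsubmx K) ->
  cvg_in_probability Pr Xeps0 0^'+ X0 ->
  limit_solution Y ->
  [/\ forall t, 0 < t ->
        cvg_in_probability Pr (fun eps => X eps t) 0^'+ (Y t),
      forall Z : R -> Om -> 'cV[R]_(k + l),
        let Z1 t w := usubmx (Z t w) in
        let Z2 t w := dsubmx (Z t w) in
        let Chat : 'M[R]_(l, n1 + n2) :=
          row_mx (alpha *m ulsubmx C + dlsubmx C)
                 (alpha *m ursubmx C + drsubmx C) in
        limit_solution Z <->
        (adapted F Z /\ continuous_paths Pr Z) /\
        [/\ ito_eq Pr W (fun _ _ => 0) 0 Z1,
            ito_eq Pr W
              (fun t w =>
                 (alpha *m ulsubmx M + dlsubmx M) *m Z1 t w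
                 + (alpha *m ursubmx M + drsubmx M) *m Z2 t w)
              (Num.sqrt 2 *: Chat) Z2,
            {ae Pr, forall w, Z1 0 w = b}
          & {ae Pr, forall w, Z2 0 w =
               alpha *m usubmx (X0 w) + dsubmx (X0 w) - alpha *m b}],
      {ae Pr, forall w, forall t, 0 <= t -> usubmx (Y t w) = usubmx (Y 0 w)}
    & {ae Pr, forall w, forall t, 0 <= t -> xi b (Y t w) = 0}].
Proof.
move=> alpha P b0 limit_solution [Fs Fm Fi] [aW cW _ _ _] mX0e mX0 solX hK cX0.
have block_equiv (Z : R -> Om -> 'cV[R]_(k + l)) :
    let Z1 t w := usubmx (Z t w) in
    let Z2 t w := dsubmx (Z t w) in
    let Chat : 'M[R]_(l, n1 + n2) :=
      row_mx (alpha *m ulsubmx C + dlsubmx C)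
             (alpha *m ursubmx C + drsubmx C) in
    limit_solution Z <->
    (adapted F Z /\ continuous_paths Pr Z) /\
    [/\ ito_eq Pr W (fun _ _ => 0) 0 Z1,
        ito_eq Pr W
          (fun t w =>
             (alpha *m ulsubmx M + dlsubmx M) *m Z1 t w
             + (alpha *m ursubmx M + drsubmx M) *m Z2 t w)
          (Num.sqrt 2 *: Chat) Z2,
        {ae Pr, forall w, Z1 0 w = b}
      & {ae Pr, forall w, Z2 0 w =
           alpha *m usubmx (X0 w) + dsubmx (X0 w) - alpha *m b}].
  move=> Z1 Z2 Chat.
  have initE w : P *m (X0 w - b0) + b0 =
      col_mx b (alpha *m usubmx (X0 w) + dsubmx (X0 w) - alpha *m b).
    rewrite /P /b0 -{1}(vsubmxK (X0 w)) opp_col_mx add_col_mx subr0.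
    rewrite mul_block_col !mul0mx addr0 mul1mx add_col_mx add0r addr0.
    by rewrite mulmxBr addrAC.
  have itoE w : ito_path (fun t => W t w) (fun t => P *m M *m Z t w)
      (Num.sqrt 2 *: (P *m C)) (fun t => Z t w) <->
    ito_path (fun t => W t w) (fun=> 0) 0 (fun t => Z1 t w) /\
    ito_path (fun t => W t w) (fun t =>
       (alpha *m ulsubmx M + dlsubmx M) *m Z1 t w
       + (alpha *m ursubmx M + drsubmx M) *m Z2 t w)
      (Num.sqrt 2 *: Chat) (fun t => Z2 t w).
    rewrite -ito_path_col_mx (noise_block_form alpha C) scale_col_mx scaler0.
    have -> : (fun t => P *m M *m Z t w) = (fun t => col_mx 0
        ((alpha *m ulsubmx M + dlsubmx M) *m Z1 t w
       + (alpha *m ursubmx M + drsubmx M) *m Z2 t w)).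
      by apply/funext => t; rewrite drift_block_form.
    by [].
  split.
    move=> [aZ cZ Z0 iZ]; split => //; split.
    - by apply: filterS iZ => w /itoE[].
    - by apply: filterS iZ => w /itoE[].
    - by apply: filterS Z0 => w Zw; rewrite /Z1 Zw initE col_mxKu.
    - by apply: filterS Z0 => w Zw; rewrite /Z2 Zw initE col_mxKd.
  move=> [[aZ cZ] [i1 i2 Z10 Z20]]; split => //.
    apply: filterS2 Z10 Z20 => w Zw1 Zw2.
    by rewrite initE -(vsubmxK (Z 0 w)) -/(Z1 0 w) -/(Z2 0 w) Zw1 Zw2.
  by apply: filterS2 i1 i2 => w Zw1 Zw2; apply/itoE.
move=> solY.
have Y1cst : {ae Pr, forall w t, 0 <= t -> usubmx (Y t w) = usubmx (Y 0 w)}.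
  have [_ [iY1 _ _ _]] := (block_equiv Y).1 solY.
  apply: filterS iY1 => w iY t t0; rewrite iY// mul0mx addr0.
  rewrite -[RHS]addr0; congr (_ + _); apply/colP => i; rewrite !mxE.
  by rewrite Rintegral_cst// mul0r.
split => //.
- move=> t t0.
  have [aY cY Y0 iY] := solY.
  have t0' := ltW t0.
  apply: (@cvg_in_probability_of_paths _ _ _ _ _ _ Xeps0 X0) => //.
  + by move=> e e0 i B mB; apply: (Fm _ t0'); have [aX _ _ _] := solX _ e0; exact: aX.
  + by move=> i B mB; apply: (Fm _ t0'); exact: aY.
  move=> e_ e_0 e_cvg.
  (* One null set for all n, as the sequence is countable. *)
  have aeX : {ae Pr, forall w, forall n,
      [/\ {within `[0%R, +oo[, continuous (fun s : R => X (e_ n) s w)},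
          X (e_ n) 0 w = Xeps0 (e_ n) w &
          ito_path (fun s => W s w)
            (fun s => penalized_drift b M K (e_ n) (X (e_ n) s w))
            (Num.sqrt 2 *: C) (fun s => X (e_ n) s w)]}.
    apply: ae_foralln => n; have [_ c1 c2 c3] := solX _ (e_0 n).
    by apply: filterS3 c1 c2 c3.
  have aeY : {ae Pr, forall w,
      [/\ {within `[0%R, +oo[, continuous (fun s : R => W s w)},
          {within `[0%R, +oo[, continuous (fun s : R => Y s w)},
          Y 0 w = P *m (X0 w - b0) + b0 &
          ito_path (fun s => W s w) (fun s => P *m M *m Y s w)
            (P *m (Num.sqrt 2 *: C)) (fun s => Y s w)]}.
    apply: filterS2 (filterI cW cY) (filterI Y0 iY) => w [c1 c2] [c3 c4].
    by split => //; rewrite -scalemxAr.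
  apply: filterS2 aeX aeY => w Xw [cWw cYw Y0w iYw] cvg0 tol tol0.
  have [rho rho0 rhoP] := @pathwise_limit R k l _ b M K (Num.sqrt 2 *: C)
    (fun s => W s w) (X0 w) (fun s => Y s w) t tol hk hK t0 tol0
    (cpath_continuous cWw) (cpath_continuous cYw) Y0w iYw.
  have [N1 N1P] := cvg0 _ rho0.
  have /cvgr0Pnorm_le/(_ _ rho0)[N2 _ N2P] := e_cvg.
  exists (maxn N1 N2) => n; rewrite geq_max => /andP[n1' n2'].
  have [cX X0w iX] := Xw n.
  apply: (rhoP (e_ n) (fun s => X (e_ n) s w)) => //.
  + by rewrite e_0 -[e_ n]ger0_norm ?(ltW (e_0 n))//=; exact: N2P.
  + exact: cpath_continuous.
  + by rewrite X0w; exact: N1P.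
- have [_ [_ _ Y10 _]] := (block_equiv Y).1 solY.
  apply: filterS2 Y1cst Y10 => w Yw Y0w t t0.
  by rewrite /xi Yw// Y0w subrr.
Qed.
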